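(* Let $n\ge 5$ and $k\neq 0$ (so $k\geq 1$) be integers. For every cactus $G\in\mathcal{C}(n,k)$ we have $$Sz_{e}(G)\ \ge\ 2n-3,$$ $$Sz_{ev}(G)\ \ge\ \tfrac12\,(n^{2}-3),$$ and in each of the two inequalities equality holds if and only if $G\cong C_{0}(n,1)$.
   Context: Graphs are finite, simple and connected. For a connected graph $G$ and vertices $u,v$, $d_G(u,v)$ is the distance; for an edge $f=xy$ and a vertex $w$, $d_G(f,w)=\min\{d_G(x,w),d_G(y,w)\}$. For an edge $e=uv$ of $G$: $n_u(e|G)$ is the number of vertices $w$ with $d_G(u,w)<d_G(v,w)$ and $n_v(e|G)$ the number with $d_G(v,w)<d_G(u,w)$; $m_u(e|G)$ is the number of edges $f$ with $d_G(f,u)<d_G(f,v)$ and $m_v(e|G)$ the number with $d_G(f,v)<d_G(f,u)$. The edge Szeged index is $Sz_e(G)=\sum_{uv\in E(G)} m_u(uv|G)\,m_v(uv|G)$ and the edge-vertex Szeged index is $Sz_{ev}(G)=\frac12\sum_{uv\in E(G)}[n_u(uv|G)m_v(uv|G)+n_v(uv|G)m_u(uv|G)]$. A cactus is a connected graph in which every block is either a cut edge or a cycle (equivalently, any two cycles have at most one common vertex). $\mathcal{C}(n,k)$ is the class of all cacti with $n$ vertices and exactly $k$ cycles. $C_0(n,1)$ is the graph formed by one triangle with $n-3$ pendant edges attached at one of its vertices. *)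

(* Defs.v *)
From mathcomp Require Import all_boot all_order all_algebra.

Set Implicit Arguments.
Unset Strict Implicit.
Unset Printing Implicit Defensive.

Import GRing.Theory.

Record sgraph := SGraph {
  svertex :> finType;
  adj : rel svertex;
  adj_sym : symmetric adj;
  adj_irrefl : irreflexive adj }.

Definition edges (G : sgraph) : {set {set G}} :=
  [set [set p.1; p.2] | p : G * G & adj p.1 p.2].

Definition graph_iso (G H : sgraph) : Prop :=
  exists2 f : G -> H, bijective f & forall x y, adj (f x) (f y) = adj x y.

(* A pair (vertex set, edge set); it is a genuine subgraph of G only under
   [is_subgraph]. *)
Notation subgr G := ({set G} * {set {set G}})%type.

Definition whole (G : sgraph) : subgr G := ([set: G], edges G).

Definition is_subgraph (G : sgraph) (H : subgr G) : bool :=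
  (H.2 \subset edges G) && [forall f in H.2, f \subset H.1].

Definition sub_le (G : sgraph) (H K : subgr G) : bool :=
  (H.1 \subset K.1) && (H.2 \subset K.2).

(* The empty pair satisfies this; [nonseparable] and [cactus] concern nonempty
   vertex sets only. *)
Definition sub_connected (G : sgraph) (H : subgr G) : bool :=
  [forall x in H.1, forall y in H.1,
     connect [rel a b | [set a; b] \in H.2] x y].

Definition del_vertex (G : sgraph) (H : subgr G) (x : G) : subgr G :=
  (H.1 :\ x, [set f in H.2 | x \notin f]).

(* Meant for connected H, where having more components after the deletion of x
   means being disconnected. *)
Definition cut_vertex (G : sgraph) (H : subgr G) (x : G) : bool :=
  (x \in H.1) && ~~ sub_connected (del_vertex H x).

Definition nonseparable (G : sgraph) (H : subgr G) : bool :=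
  [&& is_subgraph H, H.1 != set0, sub_connected H
    & [forall x, ~~ cut_vertex H x]].

Definition is_block (G : sgraph) (B : subgr G) : Prop :=
  nonseparable B /\
  forall H : subgr G, nonseparable H -> sub_le B H -> H = B.

Definition cut_edge (G : sgraph) (f : {set G}) : bool :=
  (f \in edges G) && ~~ sub_connected ([set: G], edges G :\ f).

(* A cycle is a subgraph, so that it is counted once, whatever the starting
   point and the direction of its traversal p. *)
Definition is_cycle (G : sgraph) (H : subgr G) : bool :=
  [exists m : 'I_#|G|.+1, exists p : m.-tuple G,
     [&& 2 < m, uniq p, cycle (@adj G) p, H.1 == [set x in p]
       & H.2 == [set [set x; next p x] | x in p]]].

Definition num_cycles (G : sgraph) : nat := #|[set H : subgr G | is_cycle H]|.

Definition cactus (G : sgraph) : Prop :=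
  [/\ 0 < #|G|, sub_connected (whole G) &
      forall B : subgr G, is_block B ->
        (exists2 f : {set G}, cut_edge f & B = (f, [set f])) \/ is_cycle B].

Definition cactus_class (n k : nat) (G : sgraph) : Prop :=
  [/\ cactus G, #|G| = n & num_cycles G = k].

(* Least length of a walk from x to y; a shortest walk has fewer than #|G|
   edges, and the junk value #|G| is taken when y is not reachable from x. *)
Definition dist (G : sgraph) (x y : G) : nat :=
  find (fun d => [exists p : d.-tuple G, path (@adj G) x p && (last x p == y)])
       (iota 0 #|G|).

(* As dist is at most #|G|, this is the minimum over the ends of f. *)
Definition edist (G : sgraph) (f : {set G}) (w : G) : nat :=
  \big[minn/#|G|]_(x in f) dist x w.

(* For an edge uv, [nv u v] is n_u(uv|G) and [me u v] is m_u(uv|G). *)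
Definition nv (G : sgraph) (u v : G) : nat := #|[set w | dist u w < dist v w]|.

Definition me (G : sgraph) (u v : G) : nat :=
  #|[set f in edges G | edist f u < edist f v]|.

(* Each edge uv is visited exactly once, oriented by the enumeration of G; the
   summands below are symmetric in u and v. *)
Definition edge_sum (G : sgraph) (F : G -> G -> nat) : nat :=
  \sum_(u : G) \sum_(v : G | adj u v && (enum_rank u < enum_rank v)) F u v.

Definition Sz_e (G : sgraph) : nat :=
  edge_sum (fun u v : G => me u v * me v u).

Definition Sz_ev (G : sgraph) : rat :=
  ((edge_sum (fun u v : G => nv u v * me v u + nv v u * me u v))%:R / 2)%R.

(* Triangle on the vertices 0, 1, 2; the other vertices hang from 0. This has
   the intended shape for 3 <= n. *)
Definition C0_adj (n : nat) : rel 'I_n :=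
  [rel i j | (i != j) &&
    [|| val i == 0, val j == 0 | (val i <= 2) && (val j <= 2)]].

Lemma C0_adj_sym n : symmetric (@C0_adj n).
Proof.
by move=> i j; rewrite /C0_adj /= eq_sym orbCA [(_ <= 2) && _]andbC.
Qed.

Lemma C0_adj_irrefl n : irreflexive (@C0_adj n).
Proof. by move=> i; rewrite /C0_adj /= eqxx. Qed.

Definition C0 (n : nat) : sgraph := SGraph (@C0_adj_sym n) (@C0_adj_irrefl n).

(* Main.v *)
Require Import Defs.
From mathcomp Require Import all_boot all_order all_algebra.
From mathcomp Require Import zify.

Set Implicit Arguments.
Unset Strict Implicit.
Unset Printing Implicit Defensive.

(** Fix a cycle of length g in the cactus.  Because every block is a cut edge or
    a cycle, no path outside the edge set of the cycle joins two of its vertices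
    (off_edges_connect_inj): such a path and the cycle together would form a
    nonseparable subgraph, hence lie in a block that is larger than a cycle.  So
    each vertex w has a gate, the only vertex of the cycle that w reaches without
    using edges of the cycle, and adjacent vertices have the same gate unless
    they are joined by an edge of the cycle (cactus_gated_cycle).  Along the
    cycle, the distance from w grows from the gate at unit speed in both
    directions (dist_gate), and the same holds for an edge off the cycle
    (edist_gate).

    Both indices count separations.  Say that an edge uv separates two objects
    (vertices or edges) when one is closer to u and the other closer to v, and
    let sep be the number of edges that do so.  Exchanging sums, 2 Sz_e is the
    sum of sep over the ordered pairs of edges (Sz_e_sep), and 2 Sz_ev is the sum
    of sep over the pairs of a vertex w and an edge f (edge_sum_sep).

    The main estimate (sep_gate_edge) is that an object whose gate is c 0 is
    separated at least twice from the edge c 1 c 2, once on each of the two arcs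
    between them.  When g > 3, reversing the cycle gives a second such edge.
    Write m for the number of edges; m >= n since there is a cycle.

    - Sz_e: when g = 3, each edge off the triangle counts 2 against the triangle,
      and the triangle counts 3 by itself, so that Sz_e >= 2 (m - 3) + 3.  When
      g > 3 the same counting gives strictly more.
    - Sz_ev: a vertex w is separated from each of the m - deg w edges that avoid
      it, and these pairs contribute m (n - 2).  When g = 3, the triangle edge
      opposite to the gate of w counts once more, and twice more when w is not
      on the triangle: the total is at least m (n - 2) + 2 n - 3 >= n ^ 2 - 3.
      When g > 3, two edges count once more for each w, which is too much for
      equality.

    In the case of equality g = 3 and all these estimates are exact.  This forces
    every edge off the triangle to contain its gate and all these edges to have
    the same gate, which is the shape of C0 (star_triangle).  Conversely, on that
    shape both sums are bounded edge by edge. *)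

(** * Distances to vertices and edges *)

Section Distance.

Variable G : sgraph.
Implicit Types (x y z u v w a b : G) (f : {set G}).

Lemma edgesP f :
  reflect (exists a b, adj a b /\ f = [set a; b]) (f \in edges G).
Proof.
apply: (iffP imsetP) => [[[a b] ab e]|[a [b [ab ->]]]].
  move: ab e; rewrite inE /= => ab e; exists a; exists b; split;
    [exact: ab|exact: e].
by exists (a, b); first by rewrite inE.
Qed.

Lemma adj_neq x y : adj x y -> x != y.
Proof. by move=> xy; apply/negP => /eqP e; rewrite e adj_irrefl in xy. Qed.

Lemma dist_path_leq x y p :
  path (@adj G) x p -> last x p = y -> dist x y <= size p.
Proof.
move=> px lp; rewrite /dist.
set a := (X in find X _).
have [//|lt] := leqP (find a (iota 0 #|G|)) (size p).
have sz : size p < #|G|.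
  by apply: leq_trans lt _; rewrite -[X in _ <= X](size_iota 0) find_size.
have := before_find 0 lt; rewrite nth_iota // add0n /a.
by move/negbT/existsPn/(_ (in_tuple p)); rewrite /= px lp eqxx.
Qed.

Lemma dist_eq0 x y : (dist x y == 0) = (x == y).
Proof.
apply/eqP/eqP => [d0|->]; last first.
  by apply/eqP; rewrite -leqn0 (@dist_path_leq _ _ [::]).
have n0 : 0 < #|G| by apply/card_gt0P; exists x.
move: d0; rewrite /dist; case: #|G| n0 => //= n _.
case: ifP => // /existsP[p].
by rewrite tuple0 /= => /eqP.
Qed.

Lemma distxx x : dist x x = 0.
Proof. by apply/eqP; rewrite dist_eq0. Qed.

Lemma dist_adj x y : adj x y -> dist x y = 1.
Proof.
move=> xy; apply/eqP; rewrite eqn_leq lt0n dist_eq0 adj_neq //.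
by rewrite (@dist_path_leq _ _ [:: y]) //= xy.
Qed.

Hypothesis conG : forall x y, connect (@adj G) x y.

Lemma dist_path x y :
  exists p, [/\ path (@adj G) x p, last x p = y & size p = dist x y].
Proof.
have /connectP[q] := conG x y; case/shortenP => q' pq' uq' _ ly.
have sz : size q' < #|G| by have := card_uniqP uq'; rewrite /= => <-;
  exact: max_card.
rewrite /dist; set a := (X in find X _).
have ha : has a (iota 0 #|G|).
  apply/hasP; exists (size q'); first by rewrite mem_iota.
  by apply/existsP; exists (in_tuple q'); rewrite /= pq' ly eqxx.
have := nth_find 0 ha; rewrite nth_iota;
  last by rewrite -[X in _ < X](size_iota 0) -has_find.
rewrite add0n => /existsP[p /andP[pp /eqP lp]].
by exists p; rewrite size_tuple.
Qed.

Lemma dist_sym x y : dist x y = dist y x.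
Proof.
suff le a b : dist a b <= dist b a by apply/eqP; rewrite eqn_leq !le.
have [p [pp lp <-]] := dist_path b a.
have -> : size p = size (rev (belast b p)) by rewrite size_rev size_belast.
apply: dist_path_leq.
  by rewrite -lp rev_path; under eq_path => ? ? do rewrite adj_sym.
by case: p pp lp => [|c p] //= _ _; rewrite rev_cons last_rcons.
Qed.

Lemma dist_step x y z : adj y z -> dist x z <= (dist x y).+1.
Proof.
move=> yz; have [p [pp lp <-]] := dist_path x y.
rewrite -(size_rcons p z); apply: dist_path_leq; last by rewrite last_rcons.
by rewrite rcons_path pp lp.
Qed.

(** The neighbour of y is taken towards x, where distances are measured from;
    inductions on the distance from x use this form. *)
Lemma dist_descend x y :
  x != y -> exists2 z, adj y z & dist x y = (dist x z).+1.
Proof.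
have [p [pp lp sp]] := dist_path x y.
case/lastP: p pp lp sp => [_ /= ->|p z]; first by rewrite eqxx.
rewrite rcons_path last_rcons size_rcons => /andP[pp lz] <- sp _.
exists (last x p); first by rewrite adj_sym.
apply/eqP; rewrite eqn_leq dist_step //= -sp ltnS.
exact: dist_path_leq.
Qed.

Lemma dist_leq_card x y : dist x y <= #|G|.
Proof. by rewrite /dist -[X in _ <= X](size_iota 0) find_size. Qed.

Lemma edist_set2 a b w : edist [set a; b] w = minn (dist a w) (dist b w).
Proof.
pose s := [seq x <- index_enum G | x \in [set a; b]].
have -> : edist [set a; b] w = \big[minn/#|G|]_(x <- s) dist x w.
  by rewrite big_filter.
have ms x : (x \in s) = (x == a) || (x == b).
  by rewrite mem_filter mem_index_enum andbT !inE.
have lb x : x \in s -> \big[minn/#|G|]_(y <- s) dist y w <= dist x w.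
  elim: (s) => //= c r IH; rewrite inE big_cons.
  by case/orP => [/eqP->|/IH]; lia.
have [e|[x xs e]] : \big[minn/#|G|]_(y <- s) dist y w = #|G| \/
    exists2 x, x \in s & \big[minn/#|G|]_(y <- s) dist y w = dist x w.
  elim: (s) => [|c r IH]; first by left; rewrite big_nil.
  rewrite big_cons; case: leqP => _; first by right; exists c;
    rewrite ?inE ?eqxx.
  by case: IH => [|[x xr ->]]; [left | right; exists x; rewrite ?inE ?xr ?orbT].
- have := lb a; have := lb b;
  rewrite !ms !eqxx orbT e => /(_ isT) h1 /(_ isT) h2.
  have := dist_leq_card a w; have := dist_leq_card b w; lia.
- have := lb a; have := lb b;
  rewrite !ms !eqxx orbT e => /(_ isT) h1 /(_ isT) h2.
  by move: xs; rewrite ms => /orP[] /eqP e'; subst; lia.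
Qed.

Lemma edist_eq0 f w : f \in edges G -> (edist f w == 0) = (w \in f).
Proof.
case/edgesP => a [b [_ ->]]; rewrite edist_set2 !inE ![w == _]eq_sym -!dist_eq0.
by lia.
Qed.

Lemma edist_step f y z :
  f \in edges G -> adj y z -> edist f z <= (edist f y).+1.
Proof.
case/edgesP => a [b [_ ->]] yz; rewrite !edist_set2.
have := dist_step a yz; have := dist_step b yz; lia.
Qed.

(** The end of f that is nearer to y decides in which direction to step; the
    distance to the other end changes by at most one. *)
Lemma edist_descend f y : f \in edges G -> y \notin f ->
  exists2 z, adj y z & edist f y = (edist f z).+1.
Proof.
move=> fE; have [a [b [_ ef]]] := edgesP _ fE.
rewrite ef !inE negb_or ![y == _]eq_sym => /andP[ay yb].
have [le|le] := leqP (dist a y) (dist b y).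
- have [z yz dz] := dist_descend ay; exists z => //.
  have := dist_step b yz; rewrite adj_sym in yz; have := dist_step b yz.
  rewrite !edist_set2; lia.
have [z yz dz] := dist_descend yb; exists z => //.
have := dist_step a yz; rewrite adj_sym in yz; have := dist_step a yz.
rewrite !edist_set2; lia.
Qed.

End Distance.

(** * Counting the edges that separate two objects *)

Section Separation.

Variable G : sgraph.

(** Separators are oriented from the side of o to the side of o', so that an
    edge uv is counted once, in the direction given by o; o and o' are the
    distance functions of the two objects. *)
Definition separators (o o' : G -> nat) : {set G * G} :=
  [set d | [&& adj d.1 d.2, o d.1 < o d.2 & o' d.2 < o' d.1]].

Definition sep (o o' : G -> nat) : nat := #|separators o o'|.

Lemma sep_sym o o' : sep o o' = sep o' o.
Proof.
have swapK : involutive (fun d : G * G => (d.2, d.1)) by case.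
rewrite /sep -(card_imset _ (inv_inj swapK)); apply: eq_card => -[u v].
apply/imsetP/idP => [[[x y]]|]; rewrite !inE /= => h.
  by case=> -> ->; rewrite adj_sym andbCA andbA andbC andbA andbC;
    case/and3P: h => -> -> ->.
exists (v, u) => //; rewrite !inE /= adj_sym.
by case/and3P: h => -> -> ->.
Qed.

(** A dart is an edge with a direction. Sums over darts avoid the arbitrary
    orientation chosen in edge_sum. *)
Definition dart_sum (A : G -> G -> nat) : nat :=
  \sum_(u : G) \sum_(v : G | adj u v) A u v.

(** Double counting of the triples (dart uv, x, y) with x closer to u and y
    closer to v. *)
Lemma dart_sum_sep (I J : finType) (X : {set I}) (Y : {set J})
    (F : I -> G -> nat) (H : J -> G -> nat) :
  dart_sum (fun u v => #|[set x in X | F x u < F x v]| *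
                       #|[set y in Y | H y v < H y u]|) =
  \sum_(x in X) \sum_(y in Y) sep (F x) (H y).
Proof.
have cardT (K : finType) (p : pred K) : #|[set z | p z]| = \sum_z p z.
  by rewrite -sum1dep_card big_mkcond; apply: eq_bigr => z _; case: (p z).
have cardE (K : finType) (Z : {set K}) (p : pred K) :
    #|[set z in Z | p z]| = \sum_(z in Z) p z.
  by rewrite cardT [RHS]big_mkcond; apply: eq_bigr => z _; case: (z \in Z).
rewrite /dart_sum pair_big_dep /= big_mkcond /=.
under [RHS]eq_bigr => x _ do under eq_bigr => y _ do
  rewrite /sep /separators cardT.
under [RHS]eq_bigr => x _ do rewrite exchange_big.
rewrite /= exchange_big /=; apply: eq_bigr => d _.
case: ifP => _; last by rewrite big1 // => x _; rewrite big1.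
rewrite !cardE big_distrl /=; apply: eq_bigr => x _.
rewrite big_distrr /=; apply: eq_bigr => y _.
by case: (F x _ < _); case: (H y _ < _).
Qed.

Lemma edge_sum_dart_sum (A : G -> G -> nat) :
  edge_sum (fun u v => A u v + A v u) = dart_sum A.
Proof.
rewrite /edge_sum /dart_sum.
under eq_bigr => u _ do rewrite big_split /=.
rewrite big_split /=.
have -> : \sum_(u : G) \sum_(v | adj u v && (enum_rank u < enum_rank v)) A v u =
   \sum_(u : G) \sum_(v | adj u v && (enum_rank v < enum_rank u)) A u v.
  rewrite (exchange_big_dep predT) //=; apply: eq_bigr => v _.
  by apply: eq_bigl => u; rewrite adj_sym.
rewrite -big_split /=; apply: eq_bigr => u _.
rewrite [RHS](bigID (fun v => enum_rank u < enum_rank v)) /=; congr (_ + _).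
apply: eq_bigl => v; case uv: (adj u v) => //=.
rewrite -leqNgt ltn_neqAle; case: eqP => //= /ord_inj/enum_rank_inj e.
by rewrite e adj_irrefl in uv.
Qed.

Lemma Sz_e_dart : 2 * Sz_e G = dart_sum (fun u v => me u v * me v u).
Proof.
rewrite -edge_sum_dart_sum /Sz_e /edge_sum big_distrr /=.
apply: eq_bigr => u _; rewrite big_distrr /=; apply: eq_bigr => v _.
by rewrite mul2n -addnn [X in _ = _ + X]mulnC.
Qed.

Lemma Sz_e_sep :
  2 * Sz_e G = \sum_(f in edges G) \sum_(f' in edges G) sep (edist f) (edist
    f').
Proof. by rewrite Sz_e_dart -dart_sum_sep. Qed.

Lemma edge_sum_sep : (forall x y, connect (@adj G) x y) ->
  edge_sum (fun u v : G => nv u v * me v u + nv v u * me u v) =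
  \sum_(w : G) \sum_(f in edges G) sep (dist w) (edist f).
Proof.
move=> conG; rewrite (edge_sum_dart_sum (fun u v => nv u v * me v u)).
under [RHS]eq_bigl => w do rewrite -[true](in_setT w).
rewrite -dart_sum_sep; apply: eq_bigr => u _; apply: eq_bigr => v _.
congr (_ * _); apply: eq_card => w; rewrite !inE /=.
by rewrite ![dist w _](dist_sym conG).
Qed.

End Separation.

(** * Cycles with a gate map *)

Lemma eq_set2 (T : finType) (a b x y : T) :
  [set a; b] = [set x; y] -> (a = x /\ b = y) \/ (a = y /\ b = x).
Proof.
move=> e.
have := set21 a b; have := set22 a b; rewrite e !inE.
have := set21 x y; have := set22 x y; rewrite -e !inE.
case/orP=> /eqP h1; case/orP=> /eqP h2; case/orP=> /eqP h3; case/orP=> /eqP h4;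
  subst; auto.
Qed.

Lemma leq_sum_two (T : finType) (A : {set T}) (F : T -> nat) x y :
  x \in A -> y \in A -> x != y -> F x + F y <= \sum_(z in A) F z.
Proof.
move=> xA yA xy; rewrite (bigD1 x) //= (bigD1 y) /=; last by rewrite yA eq_sym.
by rewrite addnA leq_addr.
Qed.

Section Gates.

Variable G : sgraph.
Implicit Types (x y z u v w a b : G) (f : {set G}).

(** The closed walk is indexed by all of nat with period g, so that shifting
    and reversing it need no case distinction at the ends. *)
Record cycle_param (g : nat) (c : nat -> G) : Prop := CycleParam {
  param_gt2 : 2 < g;
  param_eq : forall i j, (c i == c j) = (i == j %[mod g]);
  param_adj : forall i, adj (c i) (c i.+1) }.

(** The gate map is a retraction of the graph onto the cycle c: it collapses
    each edge that is not an edge of the cycle. *)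
Record gated_cycle (gate : G -> G) (g : nat) (c : nat -> G) : Prop :=
  GatedCycle {
  gated_param :> cycle_param g c;
  gated_onto : forall w, exists i, gate w = c i;
  gated_fix : forall i, gate (c i) = c i;
  gated_edge : forall u v, adj u v -> gate u != gate v ->
    exists i, (u = c i /\ v = c i.+1) \/ (v = c i /\ u = c i.+1) }.

Lemma param_mod g c i j :
  cycle_param g c -> i = j %[mod g] -> c i = c j.
Proof. by move=> gc e; apply/eqP; rewrite (param_eq gc) e eqxx. Qed.

Lemma param_per g c i : cycle_param g c -> c (i + g) = c i.
Proof. by move=> gc; apply: param_mod gc _; rewrite modnDr. Qed.

Lemma param_inj g c i j : cycle_param g c ->
  c i = c j -> i <= j < i + g -> i = j.
Proof.
move=> gc /eqP; rewrite (param_eq gc) => e ij.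
have ji : j = i + (j - i) by lia.
move: e; rewrite ji -{1}[i]addn0 eqn_modDl mod0n modn_small; last by lia.
by lia.
Qed.

Lemma param_rep g c (k a : nat) : cycle_param g c ->
  exists i, a <= i < a + g /\ c k = c i.
Proof.
move=> gc; have g2 := param_gt2 gc.
(* Modulo g, the summand a * (g - 1) cancels the leading a. *)
exists (a + (k + a * g.-1) %% g); split.
  by have := ltn_pmod (k + a * g.-1) (ltnW (ltnW g2)); lia.
apply: param_mod gc _; rewrite modnDmr addnCA -mulnS prednK; last by lia.
by rewrite addnC modnMDl.
Qed.

Lemma param_succ g c i j : cycle_param g c ->
  (c i.+1 == c j.+1) = (c i == c j).
Proof. by move=> gc; rewrite !(param_eq gc) -addn1 -(addn1 j) eqn_modDr. Qed.

Lemma gated_shift gate g c k :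
  gated_cycle gate g c -> gated_cycle gate g (fun i => c (i + k)).
Proof.
move=> gc; case: (gc) => [[g2 ce ca] co cf cE].
have rep i : c (i + k * g.-1 + k) = c i.
  apply: param_mod gc _; rewrite -addnA [_ + k]addnC -mulnS prednK; last by lia.
  by rewrite addnC modnMDl.
split=> [|w|i|u v uv nuv]; last 1 first.
- have [i uvi] := cE u v uv nuv; exists (i + k * g.-1).
  by rewrite -addSn; have := rep i.+1; rewrite addSn => ->; rewrite rep.
- by split=> // i j; rewrite ce eqn_modDr.
- by have [i ->] := co w; exists (i + k * g.-1); rewrite rep.
- exact: cf.
Qed.

(** Multiplication by g - 1 is negation modulo g, which stays inside nat. *)
Lemma gated_rev gate g c :
  gated_cycle gate g c -> gated_cycle gate g (fun i => c (i * g.-1)).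
Proof.
move=> gc; case: (gc) => [[g2 ce ca] co cf cE].
have rep i : c (i * g.-1 * g.-1) = c i.
  apply: param_mod gc _.
  have -> : i * g.-1 * g.-1 = i * g.-2 * g + i.
    by rewrite -!mulnA -mulnSr; congr (_ * _); case: (g) g2 => [|[|m]] //=; lia.
  by rewrite modnMDl.
have repS i : c (i.+1 * g.-1).+1 = c (i * g.-1).
  by rewrite mulSn addnC -addnS prednK ?(param_per _ gc) //; lia.
split=> [|w|i|u v uv nuv]; first split=> // [i j|i].
- apply/eqP/eqP => e; last by apply: param_mod gc _; rewrite -modnMml e modnMml.
  apply/eqP; rewrite -ce -rep -(rep j); apply/eqP/(param_mod gc).
  move/eqP: e; rewrite ce => /eqP e.
  by rewrite -modnMml e modnMml.
- by rewrite adj_sym -(repS i); exact: ca.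
- by have [i ->] := co w; exists (i * g.-1); rewrite rep.
- exact: cf.
have [i uvi] := cE u v uv nuv; exists (i.+1 * g.-1).
have -> : c ((i.+1 * g.-1).+1 * g.-1) = c i.
  apply/eqP; rewrite -(param_succ _ _ gc); apply/eqP.
  by rewrite mulSn addnC -addnS prednK ?(param_per _ gc) ?rep //; lia.
by rewrite rep; case: uvi => -[-> ->]; [right|left].
Qed.

End Gates.

(** * Distances seen from a gate *)

Section GateDistances.

Variable G : sgraph.
Implicit Types (x y z u v w a b : G) (f : {set G}).

Hypothesis conG : forall x y, connect (@adj G) x y.

Variables (gate : G -> G) (g : nat).
Implicit Types c : nat -> G.
Let gated := gated_cycle gate g.

(** A shortest path from w to v must pass through the gate c 0 and then follow
    the cycle: on the way back from v to w, each step either keeps the gate or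
    moves it to a neighbour on the cycle. *)
Lemma dist_gate_geq c w v i : gated c -> gate w = c 0 -> 0 < i < g ->
  gate v = c i -> dist w (c 0) + minn i (g - i) <= dist w v.
Proof.
move=> gc gw; have g2 := param_gt2 gc.
have [d] := ubnP (dist w v); elim: d v i => // d IH v i;
  rewrite ltnS => dv ig gv.
have wv : w != v.
  apply/negP => /eqP e; move: gv; rewrite -e gw => /(param_inj gc); lia.
have [z vz dz] := dist_descend conG wv.
have [e|/(gated_edge gc vz)[k]] := eqVneq (gate v) (gate z).
  by have := IH z i; rewrite -e => h; have := h _ _ gv; lia.
case=> [[ev ez]|[ez ev]].
- have zi : z = c i.+1.
    by apply/eqP; rewrite ez (param_succ _ _ gc) -gv ev (gated_fix gc).
  have [lt|ge] := ltnP i.+1 g.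
    have gz : gate z = c i.+1 by rewrite zi (gated_fix gc).
    have := IH z i.+1 _ _ gz; lia.
  (* The step closes the cycle and lands on c g = c 0. *)
have i1 : i.+1 = 0 + g by lia.
  move: dz; rewrite zi i1 (param_per _ gc); lia.
have zi : z = c i.-1.
  apply/eqP; rewrite ez -(param_succ _ _ gc) prednK; last by lia.
  by rewrite -gv ev (gated_fix gc).
have [lt|ge] := ltnP 0 i.-1.
  have gz : gate z = c i.-1 by rewrite zi (gated_fix gc).
  have := IH z i.-1 _ _ gz; lia.
have i1 : i.-1 = 0 by lia.
move: dz; rewrite zi i1; lia.
Qed.

(** The upper bound comes from walking along the cycle from c 0 in either
    direction; together with the lower bound it says that cycles of a cactus
    are isometric. *)
Lemma dist_gate c w i : gated c -> gate w = c 0 -> i <= g ->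
  dist w (c i) = dist w (c 0) + minn i (g - i).
Proof.
move=> gc gw ig.
have up k : dist w (c k) <= dist w (c 0) + k.
  elim: k => [|k IH]; first by rewrite addn0.
  by have := dist_step conG w (param_adj gc k); lia.
have down k : k <= g -> dist w (c (g - k)) <= dist w (c 0) + k.
  elim: k => [|k IH] kg.
    by rewrite subn0 -[g]add0n (param_per _ gc) addn0.
  have := param_adj gc (g - k.+1); rewrite subnSK // adj_sym.
  by move/(dist_step conG w); have := IH (ltnW kg); lia.
have [->|i0] := posnP i; first by rewrite min0n addn0.
have [->|lt] := eqVneq i g.
  by rewrite subnn minn0 addn0 -[g]add0n (param_per _ gc).
have := dist_gate_geq (v := c i) gc gw _ (gated_fix gc i).
have := up i; have := down (g - i); rewrite subKn //; lia.
Qed.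

Lemma edist_gate c a b i : gated c -> gate a = c 0 -> gate b = c 0 ->
  i <= g -> edist [set a; b] (c i) = edist [set a; b] (c 0) + minn i (g - i).
Proof.
move=> gc ga gb ig; rewrite !edist_set2.
by have := dist_gate gc ga ig; have := dist_gate gc gb ig;
  move: (minn i _) => ?; lia.
Qed.

Lemma edist_cycle c k i : gated c -> 0 < i <= g ->
  edist [set c k; c k.+1] (c (k + i)) = minn i.-1 (g - i).
Proof.
move=> gc ig; rewrite edist_set2.
have g0 := gated_shift k gc; have g1 := gated_shift k.+1 gc.
have ->: dist (c k) (c (k + i)) = minn i (g - i).
  have := @dist_gate _ (c k) i g0;
    rewrite add0n (gated_fix gc) distxx addnC add0n.
  by apply=> //; lia.
have ->: dist (c k.+1) (c (k + i)) = minn i.-1 (g - i.-1).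
  have -> : k + i = i.-1 + k.+1 by lia.
  have := @dist_gate _ (c k.+1) i.-1 g1;
    rewrite add0n (gated_fix gc) distxx add0n.
  by apply=> //; lia.
lia.
Qed.

Lemma sep_two o o' d1 d2 : d1 \in separators o o' -> d2 \in separators o o' ->
  d1 != d2 -> 2 <= sep (G := G) o o'.
Proof.
move=> h1 h2 ne; have <- : #|[set d1; d2]| = 2 by rewrite cards2 ne.
by apply/subset_leq_card/subsetP => d; rewrite in_set2 => /orP[] /eqP ->.
Qed.

Lemma sep_gt0 o o' d : d \in separators o o' -> 0 < sep (G := G) o o'.
Proof. by move=> h; apply/card_gt0P; exists d. Qed.

(** This is what the estimates below need of the distance function o of an
    object with gate c 0; vertices and edges off the cycle both satisfy it. *)
Definition rises_from_gate c (o : G -> nat) :=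
  forall i, i <= g -> o (c i) = o (c 0) + minn i (g - i).

Lemma separators_near c o : gated c -> rises_from_gate c o ->
  (c 0, c 1) \in separators o (edist [set c 1; c 2]).
Proof.
move=> gc ho; have g2 := param_gt2 gc; rewrite inE /= (param_adj gc) /=.
have h0 := @edist_cycle c 1 g.-1 gc; have h1 := @edist_cycle c 1 g gc.
have e0 : 1 + g.-1 = 0 + g by lia.
rewrite e0 (param_per _ gc) in h0; rewrite (param_per _ gc) in h1.
have := ho 1; lia.
Qed.

(** On the arc from c 2 back to c g = c 0, the value of o decreases from the
    middle of the cycle on, while the distance to the edge c 1 c 2 increases
    until one step past the middle; the dart c j.+1 -> c j at the middle sees
    both. *)
Lemma separators_far c o j : gated c -> rises_from_gate c o ->
  g <= j + j <= g.+1 -> (c j.+1, c j) \in separators o (edist [set c 1; c 2]).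
Proof.
move=> gc ho jg; have g2 := param_gt2 gc.
rewrite inE /= adj_sym (param_adj gc) /=.
have h0 := @edist_cycle c 1 j.-1 gc; have h1 := @edist_cycle c 1 j gc.
have e0 : 1 + j.-1 = j by lia.
rewrite e0 in h0; rewrite add1n in h1.
rewrite (ho j) ?(ho j.+1) //; [|lia|lia].
rewrite h0 ?h1; [|lia|lia]; move: jg g2; clear; lia.
Qed.

Lemma sep_gate_edge c o : gated c -> rises_from_gate c o ->
  2 <= sep o (edist [set c 1; c 2]).
Proof.
move=> gc ho; have g2 := param_gt2 gc.
have [j jg] : exists j, g <= j + j <= g.+1.
  by exists (uphalf g); have := odd_double_half g; rewrite uphalf_half; lia.
apply: sep_two (separators_near gc ho) (separators_far gc ho jg) _.
rewrite xpair_eqE negb_and; apply/orP; right; apply/negP => /eqP/(param_inj gc).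
lia.
Qed.

(** One separator is the edge c 1 c 2 between the two edges, the other lies in
    the middle of the opposite arc. *)
Lemma sep_cycle_edges c : gated c -> 3 < g ->
  2 <= sep (edist [set c 0; c 1]) (edist [set c 2; c 3]).
Proof.
move=> gc g3.
have [j jg] : exists j, g < j + j <= g.+2.
  by exists g./2.+1; have := odd_double_half g; lia.
have h i : 0 < i <= g -> edist [set c 0; c 1] (c i) = minn i.-1 (g - i).
  exact: (@edist_cycle c 0 i gc).
have h' i : 2 < i <= g.+2 -> edist [set c 2;
  c 3] (c i) = minn (i - 3) (g.+2 - i).
  move=> ig; have := @edist_cycle c 2 (i - 2) gc.
  have -> : 2 + (i - 2) = i by lia.
  by move=> ->; lia.
apply: (@sep_two _ _ (c 1, c 2) (c j.+1, c j)).
- rewrite inE /= (param_adj gc) (h 1) ?(h 2) /=; [|lia|lia].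
  have := h' (1 + g); have := h' (2 + g); rewrite !(param_per _ gc).
  by move=> -> ; [move=> -> ; lia | lia].
- rewrite inE /= adj_sym (param_adj gc) (h j) ?(h' j) ?(h' j.+1) /=;
  [|lia|lia|lia].
  have -> : edist [set c 0; c 1] (c j.+1) = g - j.+1; last by lia.
  have [e|lt] := eqVneq j g; last by rewrite h; lia.
  by rewrite e -[g.+1]add1n (param_per _ gc) h; lia.
rewrite xpair_eqE negb_and; apply/orP; right; apply/negP => /eqP/(param_inj gc).
lia.
Qed.

(** In a triangle, two edges are separated by the third one. *)
Lemma sep_triangle_edges c : gated c -> g = 3 ->
  0 < sep (edist [set c 0; c 1]) (edist [set c 1; c 2]).
Proof.
move=> gc g3; apply: (@sep_gt0 _ _ (c 0, c 2)).
have h i := @edist_cycle c 0 i gc; have h' i := @edist_cycle c 1 i gc.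
rewrite inE /= adj_sym.
have e3 : c 3 = c 0 by rewrite -g3 -[g]add0n (param_per _ gc).
have := param_adj gc 2; rewrite e3 => -> /=.
by have := h 2; have := h 3; have := h' 1; have := h' 2;
  rewrite !add0n !add1n e3 g3; lia.
Qed.

End GateDistances.

(** * Edges on the cycle and off the cycle *)

Section GateCounting.

Variable G : sgraph.
Implicit Types (x y z u v w a b : G) (f : {set G}).

Hypothesis conG : forall x y, connect (@adj G) x y.

Variables (gate : G -> G) (g : nat).
Implicit Types c : nat -> G.
Let gated := gated_cycle gate g.

(** By gated_edge these are exactly the edges of the cycle. Reading them off
    the gate map makes the set independent of the parametrization, which is
    shifted and reversed freely below. *)
Definition cycle_edges : {set {set G}} :=
  [set [set p.1; p.2] | p : G * G & adj p.1 p.2 && (gate p.1 != gate p.2)].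

Lemma cycle_edgesP c f : gated c ->
  reflect (exists i, f = [set c i; c i.+1]) (f \in cycle_edges).
Proof.
move=> gc; apply: (iffP imsetP) => [[[u v]]|[i ->]].
  rewrite inE /= => /andP[uv nuv ->].
  have [i [[-> ->]|[-> ->]]] := gated_edge gc uv nuv; exists i => //.
  exact: setUC.
exists (c i, c i.+1) => //; rewrite inE /= (param_adj gc) !(gated_fix gc).
exact: adj_neq (param_adj gc i).
Qed.

Lemma cycle_edges_sub : cycle_edges \subset edges G.
Proof.
apply/subsetP => f /imsetP[[u v]]; rewrite inE /= => /andP[uv _ ->].
by apply/edgesP; exists u, v.
Qed.

Lemma off_cycle_edgeP f : f \in edges G :\: cycle_edges ->
  exists a b, [/\ adj a b, f = [set a; b] & gate a = gate b].
Proof.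
rewrite inE => /andP[fC /edgesP[a [b [ab e]]]]; exists a, b; split=> //.
apply/eqP; apply: contraNT fC => ne; rewrite e; apply/imsetP.
by exists (a, b); rewrite ?inE /= ?ab.
Qed.

(** Shifting the parametrization, the gate of a given object can be taken to
    be c 0. *)
Lemma gated_at c w : gated c -> exists2 c', gated c' & gate w = c' 0.
Proof.
move=> gc; have [k e] := gated_onto gc w.
by exists (fun i => c (i + k)); [exact: gated_shift|].
Qed.

Lemma gated_reverse c : gated c ->
  exists2 c', gated c' & forall i, i <= g -> c' i = c (g - i).
Proof.
move=> gc; exists (fun i => c (i * g.-1)); first exact: gated_rev.
move=> i ig; have g2 := param_gt2 gc; apply: param_mod gc _.
rewrite -(modnDr (i * _)); have -> : i * g.-1 + g = i * g + (g - i).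
  by case: (g) g2 ig => // m _ im; rewrite /= mulnS; lia.
by rewrite modnMDl.
Qed.

(** The reflection that exchanges the ends of the edge c 0 c 1. *)
Lemma gated_flip c : gated c -> exists2 c', gated c' &
  [/\ c' 0 = c 1, c' 1 = c 0, c' 2 = c g.-1 & c' 3 = c g.-2].
Proof.
move=> gc; have g2 := param_gt2 gc; have [c' gc' e] := gated_reverse gc.
exists (fun i => c' (i + g.-1)); first exact: gated_shift.
have -> : 1 + g.-1 = g by lia.
have -> : 2 + g.-1 = 1 + g by lia.
have -> : 3 + g.-1 = 2 + g by lia.
rewrite !(param_per _ gc') !e ?add0n; try lia.
by split; congr c; lia.
Qed.

Lemma gated_neq c i j : gated c -> i < j < i + g -> c i != c j.
Proof. by move=> gc ij; apply/negP => /eqP/(param_inj gc); lia. Qed.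

Lemma set2_neq (T : finType) (a b x y : T) :
  a != x -> a != y -> [set a; b] != [set x; y].
Proof.
move=> ax ay; apply: contraTneq (set21 a b) => ->.
by rewrite !inE negb_or ax.
Qed.

Lemma card_cycle_edges c : gated c -> #|cycle_edges| = g.
Proof.
move=> gc; have g2 := param_gt2 gc.
have -> : cycle_edges = [set [set c i; c i.+1] | i : 'I_g].
  apply/setP => f; apply/(cycle_edgesP f gc)/imsetP => [[i ->]|[i _ ->]].
    have lt : i %% g < g by rewrite ltn_mod; lia.
    have e : c (i %% g) = c i by apply: param_mod gc _; rewrite modn_mod.
    exists (Ordinal lt) => //=; rewrite e; congr [set _; _].
    by apply/eqP; rewrite (param_succ _ _ gc) e.
  by exists i.
rewrite card_imset ?card_ord // => i j /eq_set2[[e _]|[e1 e2]].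
  apply/val_inj; have [le|le] := leqP i j.
    by apply: param_inj gc e _; have := ltn_ord j; lia.
  by apply/esym; apply: param_inj gc (esym e) _; have := ltn_ord i; lia.
have e : c i.+2 = c i.
  by move/eqP: e2; rewrite -(param_succ _ _ gc) -e1 => /eqP.
by have := gated_neq (i := i) (j := i.+2) gc; rewrite e eqxx; lia.
Qed.

Lemma card_cycle_vertices c : gated c -> #|[set w | gate w == w]| = g.
Proof.
move=> gc; have g2 := param_gt2 gc.
have -> : [set w | gate w == w] = [set c i | i : 'I_g].
  apply/setP => w; rewrite inE; apply/eqP/imsetP => [<-|[i _ ->]].
    have [i ->] := gated_onto gc w.
    have lt : i %% g < g by rewrite ltn_mod; lia.
    by exists (Ordinal lt) => //=; apply: param_mod gc _; rewrite modn_mod.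
  exact: gated_fix gc i.
rewrite card_imset ?card_ord // => i j e.
apply/val_inj; have [le|le] := leqP i j.
  by apply: param_inj gc e _; have := ltn_ord j; lia.
by apply/esym; apply: param_inj gc (esym e) _; have := ltn_ord i; lia.
Qed.

(** A vertex off the cycle is sent to the first edge of a shortest path to its
    gate; this is injective because the distance to the gate decreases along
    that edge, and its values are edges off the cycle. The cycle itself has as
    many edges as vertices. *)
Lemma leq_card_edges c : gated c -> #|G| <= #|edges G|.
Proof.
move=> gc.
pose h w := dist w (gate w).
have ex w : gate w != w ->
    exists z, [&& adj w z, gate w == gate z & h z < h w].
  rewrite eq_sym => ne; have := ne;
    rewrite eq_sym => /(dist_descend conG)[z wz dz].
  have gwz : gate w = gate z.
    apply/eqP/negPn/negP => /(gated_edge gc wz)[i [] [e e']].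
      by rewrite e (gated_fix gc) eqxx in ne.
    by rewrite e' (gated_fix gc) eqxx in ne.
  exists z; rewrite wz gwz eqxx /h -gwz (dist_sym conG z) (dist_sym conG w) dz.
  exact: leqnn.
pose next w := odflt w [pick z | [&& adj w z, gate w == gate z & h z < h w]].
have nextP w : gate w != w ->
    [&& adj w (next w), gate w == gate (next w) & h (next w) < h w].
  move=> /ex[z hz]; rewrite /next; case: pickP => //= none.
  by rewrite none in hz.
have le : #|[set w | gate w != w]| <= #|edges G :\: cycle_edges|.
  have inj : {in [set w | gate w != w] &, injective (fun w => [set w; next w])}.
    move=> u v; rewrite !inE => /nextP/and3P[_ _ hu] /nextP/and3P[_ _ hv].
    by case/eq_set2 => [[]//|[e1 e2]]; move: hu hv; rewrite e2 -e1; lia.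
  rewrite -(card_in_imset inj); apply/subset_leq_card/subsetP => f.
  case/imsetP => w; rewrite inE => /nextP/and3P[aw /eqP gw _ ->]; rewrite inE.
  apply/andP; split; last by apply/edgesP; exists w, (next w).
  apply/imsetP => -[[u v]]; rewrite inE /= => /andP[_ nuv].
  by case/eq_set2 => -[eu ev]; rewrite -eu -ev gw eqxx in nuv.
have -> : #|G| = #|[set w | gate w == w]| + #|[set w | gate w != w]|.
  rewrite -cardsT -(cardsID [set w | gate w == w]) setTI setTD.
  by congr (_ + _); apply: eq_card => w; rewrite !inE.
have -> : #|edges G| = #|cycle_edges| + #|edges G :\: cycle_edges|.
  by rewrite -(cardsID cycle_edges) (setIidPr cycle_edges_sub).
by rewrite (card_cycle_vertices gc) (card_cycle_edges gc) leq_add2l.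
Qed.

(** The edges c 1 c 2 and c (g - 1) c (g - 2) are both separated twice from o;
    they coincide exactly when g = 3, which explains the factor. *)
Lemma sum_sep_rises c o : gated c -> rises_from_gate g c o ->
  2 * (g != 3).+1 <= \sum_(f in cycle_edges) sep o (edist f).
Proof.
move=> gc ho; have g2 := param_gt2 gc.
have f1 : [set c 1; c 2] \in cycle_edges by apply/(cycle_edgesP _ gc); exists 1.
have [e3|ne3] := eqVneq g 3.
  by rewrite (bigD1 _ f1) /=; have := sep_gate_edge conG gc ho; lia.
have [c' gc' e'] := gated_reverse gc.
have ho' : rises_from_gate g c' o.
  move=> i ig; rewrite !e' // ho ?leq_subr // subn0 -[in c g](add0n g).
  by rewrite (param_per _ gc) subKn //; lia.
have f2 : [set c' 1; c' 2] \in cycle_edges.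
  by apply/(cycle_edgesP _ gc'); exists 1.
apply: leq_trans (leq_sum_two _ f1 f2 _).
  have := sep_gate_edge conG gc ho; have := sep_gate_edge conG gc' ho'.
  by rewrite /=; lia.
by rewrite !e'; [apply: set2_neq; apply: (gated_neq gc)| |]; lia.
Qed.

Lemma sum_sep_off_cycle c f : gated c -> f \in edges G :\: cycle_edges ->
  2 * (g != 3).+1 <= \sum_(f' in cycle_edges) sep (edist f) (edist f').
Proof.
move=> gc /off_cycle_edgeP[a [b [_ -> ab]]].
have [c' gc' e] := gated_at a gc; apply: (sum_sep_rises gc') => i ig.
by apply: (edist_gate conG gc'); rewrite -?ab.
Qed.

(** In a triangle each of the two other edges counts once. Otherwise the edges
    at offset 2 and -2 count twice each; they coincide when g = 4. *)
Lemma sum_sep_on_cycle c0 f : gated c0 -> f \in cycle_edges ->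
  2 * (4 < g).+1 <= \sum_(f' in cycle_edges) sep (edist f) (edist f').
Proof.
move=> gc0 /(cycle_edgesP _ gc0)[k ef].
have [c gc {ef}->] : exists2 c, gated c & f = [set c 0; c 1].
  by exists (fun i => c0 (i + k)); [exact: gated_shift|rewrite add0n add1n].
have g2 := param_gt2 gc.
have [c' gc' [e0 e1 e2 e3]] := gated_flip gc.
have fl : [set c 0; c 1] = [set c' 0; c' 1] by rewrite e0 e1 setUC.
have inE' c1 i : gated c1 -> [set c1 i; c1 i.+1] \in cycle_edges.
  by move=> gc1; apply/(cycle_edgesP _ gc1); exists i.
have [g3|ne3] := eqVneq g 3.
  apply: leq_trans (leq_sum_two _ (inE' c 1 gc) (inE' c' 1 gc') _).
    have := sep_triangle_edges conG gc g3;
      have := sep_triangle_edges conG gc' g3.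
    by rewrite -fl; lia.
  by rewrite e1 e2; apply: set2_neq; [rewrite eq_sym|]; apply: (gated_neq gc);
    lia.
have s1 := sep_cycle_edges conG gc; have s2 := sep_cycle_edges conG gc'.
have [g5|g4] := ltnP 4 g; last first.
  by rewrite (bigD1 _ (inE' c 2 gc)) /=; have := s1; lia.
apply: leq_trans (leq_sum_two _ (inE' c 2 gc) (inE' c' 2 gc') _).
  by move: s1 s2; rewrite -fl; lia.
by rewrite e2 e3; apply: set2_neq; apply: (gated_neq gc); lia.
Qed.

Lemma Sz_e_split : 2 * Sz_e G =
  \sum_(f in edges G :\: cycle_edges) \sum_(f' in edges G :\: cycle_edges)
     sep (edist f) (edist f')
  + 2 * (\sum_(f in edges G :\: cycle_edges) \sum_(f' in cycle_edges)
     sep (edist f) (edist f'))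
  + \sum_(f in cycle_edges) \sum_(f' in cycle_edges) sep (edist f) (edist f').
Proof.
have splitE (F : {set G} -> nat) : \sum_(f in edges G) F f =
    \sum_(f in edges G :\: cycle_edges) F f + \sum_(f in cycle_edges) F f.
  rewrite [RHS]addnC (bigID (mem cycle_edges)) /=; congr (_ + _);
    apply: eq_bigl => f; last by rewrite !inE andbC.
  by apply/andP/idP => [[]|fC]; last rewrite (subsetP cycle_edges_sub _ fC).
rewrite Sz_e_sep splitE.
under eq_bigr => f _ do rewrite splitE.
under [X in _ + X]eq_bigr => f _ do rewrite splitE.
rewrite !big_split /= mul2n -addnn.
rewrite [X in _ + (X + _) = _]exchange_big /=.
under [X in _ + (X + _) = _]eq_bigr => f _ do under eq_bigr =>
  f' _ do rewrite sep_sym.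
by rewrite !addnA.
Qed.

(** Pairs with both edges off the cycle are discarded; mixed pairs occur in
    both orders, which doubles their contribution. *)
Lemma Sz_e_cycle_leq c : gated c ->
  4 * (g != 3).+1 * (#|edges G| - g) + 2 * (4 < g).+1 * g <= 2 * Sz_e G.
Proof.
move=> gc; rewrite Sz_e_split.
have cO : #|edges G :\: cycle_edges| = #|edges G| - g.
  by rewrite cardsD (setIidPr cycle_edges_sub) (card_cycle_edges gc).
have sO : 2 * (g != 3).+1 * (#|edges G| - g) <=
    \sum_(f in edges G :\: cycle_edges) \sum_(f' in cycle_edges)
       sep (edist f) (edist f').
  rewrite -cO mulnC -sum_nat_const; apply: leq_sum => f;
    exact: sum_sep_off_cycle gc.
have sC : 2 * (4 < g).+1 * g <=
    \sum_(f in cycle_edges) \sum_(f' in cycle_edges) sep (edist f) (edist f').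
  rewrite -{2}(card_cycle_edges gc) mulnC -sum_nat_const; apply: leq_sum => f.
  exact: sum_sep_on_cycle gc.
by lia.
Qed.

End GateCounting.

(** * Nonseparable subgraphs and added paths *)

Section EarsAndBlocks.

Variable G : sgraph.
Implicit Types (x y z u v w a b : G) (f : {set G}) (H K B : subgr G).

Fixpoint path_edges x (p : seq G) : seq {set G} :=
  if p is y :: p' then [set x; y] :: path_edges y p' else [::].

Lemma path_edges_cat x p q :
  path_edges x (p ++ q) = path_edges x p ++ path_edges (last x p) q.
Proof. by elim: p x => //= y p IH x; rewrite IH. Qed.

Lemma path_edges_sub x p f v : f \in path_edges x p -> v \in f -> v \in x :: p.
Proof.
elim: p x => //= y p IH x; rewrite inE => /orP[/eqP->|/IH h /h].
  by rewrite !inE => /orP[] ->; rewrite ?orbT.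
by rewrite !inE => ->; rewrite orbT.
Qed.

Lemma path_edges_edges x p f :
  path (@adj G) x p -> f \in path_edges x p -> f \in edges G.
Proof.
elim: p x => //= y p IH x /andP[xy yp];
  rewrite inE => /orP[/eqP->|/(IH _ yp)//].
by apply/edgesP; exists x, y.
Qed.

(** Adjacency through a prescribed set of edges, as in sub_connected; used for
    the edges of a subgraph and for what remains of them after deleting a
    vertex. *)
Definition edge_rel (E : {set {set G}}) : rel G := [rel a b | [set a; b] \in E].

Lemma edge_rel_sym E x y : connect (edge_rel E) x y = connect (edge_rel E) y x.
Proof. by apply: sym_connect_sym => a b; rewrite /edge_rel /= setUC. Qed.

Lemma edge_rel_mono (E F : {set {set G}}) x y : E \subset F ->
  connect (edge_rel E) x y -> connect (edge_rel F) x y.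
Proof.
move=> /subsetP EF; apply: connect_sub => a b ab; apply: connect1; exact: EF.
Qed.

Lemma path_edges_connect (E : {set {set G}}) x p :
  {subset path_edges x p <= E} -> connect (edge_rel E) x (last x p).
Proof.
elim: p x => //= y p IH x sub; apply: (@connect_trans _ _ y).
  by apply: connect1; apply: sub; rewrite inE eqxx.
by apply: IH => f fp; apply: sub; rewrite inE fp orbT.
Qed.

Lemma sub_connectedP H :
  reflect {in H.1 &, forall x y, connect (edge_rel H.2) x y} (sub_connected H).
Proof.
apply: (iffP forall_inP) => [h x y xH yH|h x xH].
  by move/forall_inP: (h x xH); apply.
by apply/forall_inP => y; exact: h.
Qed.

Definition add_path H x p : subgr G :=
  (H.1 :|: [set v in p], H.2 :|: [set f in path_edges x p]).

Definition avoiding (E : {set {set G}}) v : {set {set G}} :=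
  [set f in E | v \notin f].

Lemma path_edges_prefix (E : {set {set G}}) x p z :
  {subset path_edges x p <= E} -> z \in p -> connect (edge_rel E) x z.
Proof.
move=> sub zp; have zxp : z \in x :: p by rewrite inE zp orbT.
case/splitPl: p / zxp sub {zp} => p1 p2 lp sub.
rewrite -lp; apply: path_edges_connect => f fp; apply: sub.
by rewrite path_edges_cat mem_cat fp.
Qed.

(** Cutting a simple path at v leaves z connected to one of its two ends. *)
Lemma path_edges_avoiding (E : {set {set G}}) x p v z :
  uniq (x :: p) -> {subset path_edges x p <= E} -> z \in p -> z != v ->
  (x != v /\ connect (edge_rel (avoiding E v)) z x) \/
  (last x p != v /\ connect (edge_rel (avoiding E v)) z (last x p)).
Proof.
move=> up sub zp zv; have zxp : z \in x :: p by rewrite inE zp orbT.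
case/splitPl: p / zxp up sub {zp} => p1 p2 lp up sub.
have avoid y q : {subset path_edges y q <= E} -> v \notin y :: q ->
    connect (edge_rel (avoiding E v)) y (last y q).
  move=> sq nv; apply: path_edges_connect => f fq; rewrite inE sq //=.
  by apply: contra nv; exact: path_edges_sub.
have [vp1|vp1] := boolP (v \in x :: p1); [right|left]; last first.
  split; first by apply: contraNneq vp1 => ->; rewrite inE eqxx.
  rewrite edge_rel_sym -lp; apply: avoid => // f fp; apply: sub.
  by rewrite path_edges_cat mem_cat fp.
have vp2 : v \notin z :: p2.
  rewrite inE negb_or eq_sym zv /=; move: up; rewrite -cat_cons cat_uniq.
  by case/and3P=> _ /hasPn h _; apply/negP => /h; rewrite vp1.
rewrite last_cat lp; split.
  by apply: contraNneq vp2 => <-; exact: mem_last.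
apply: avoid => // f fp; apply: sub.
by rewrite path_edges_cat mem_cat lp fp orbT.
Qed.

(** After the deletion of a vertex v, each remaining vertex of the added path
    is still connected to one of its ends, hence to the rest of H, which is
    itself connected after the deletion. The path may meet H in interior
    vertices too. *)
Lemma nonseparable_add_path H x p : nonseparable H ->
  x \in H.1 -> last x p \in H.1 ->
  path (@adj G) x p -> uniq (x :: p) -> nonseparable (add_path H x p).
Proof.
case/and4P=> /andP[/subsetP Hedge /forall_inP Hsub] Hn0 /sub_connectedP Hcon.
move=> /forallP Hcut xH yH xp up; set K := add_path H x p.
have HK : H.2 \subset K.2 by exact: subsetUl.
have pK : {subset path_edges x p <= K.2} by move=> f fp; rewrite !inE fp orbT.
apply/and4P; split.
- apply/andP; split.
    apply/subsetP => f; rewrite inE => /orP[/Hedge//|].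
    by rewrite inE; exact: path_edges_edges.
  apply/forall_inP => f; rewrite inE => /orP[/Hsub/subsetP fH|].
    by apply/subsetP => v /fH; rewrite inE => ->.
  rewrite inE => fp; apply/subsetP => v /(path_edges_sub fp).
  by rewrite !inE => /orP[/eqP->|->]; rewrite ?xH ?orbT.
- by apply/set0Pn; exists x; rewrite inE xH.
- have to_x z : z \in K.1 -> connect (edge_rel K.2) x z.
    rewrite inE => /orP[zH|]; first exact: edge_rel_mono HK (Hcon x z xH zH).
    by rewrite inE; exact: path_edges_prefix.
  apply/sub_connectedP => y z /to_x; rewrite edge_rel_sym => yx /to_x.
  exact: connect_trans.
apply/forallP => v; rewrite /cut_vertex negb_and negbK; apply/orP; right.
have HKv : avoiding H.2 v \subset avoiding K.2 v.
  by apply/subsetP => f; rewrite !inE => /andP[-> ->].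
have conH y z : y \in H.1 -> z \in H.1 -> y != v -> z != v ->
    connect (edge_rel (avoiding K.2 v)) y z.
  move=> yH' zH yv zv; apply: edge_rel_mono HKv _.
  have [vH|vH] := boolP (v \in H.1).
    have := Hcut v; rewrite /cut_vertex vH negbK => /sub_connectedP; apply.
      by rewrite !inE yv.
    by rewrite !inE zv.
  apply: edge_rel_mono (Hcon y z yH' zH); apply/subsetP => f fH.
  by rewrite inE fH; apply: contra vH; apply/subsetP; exact: Hsub.
have toH z : z \in K.1 -> z != v ->
    exists h, [/\ h \in H.1, h != v & connect (edge_rel (avoiding K.2 v)) z h].
  rewrite inE => /orP[zH|] zv; first by exists z.
  move: zv; rewrite inE => zp zv.
  by have [[xv zx]|[yv zy]] := path_edges_avoiding up pK zp zv;
    [exists x | exists (last x p)].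
apply/sub_connectedP => y z; rewrite !inE.
move=> /andP[yv yK] /andP[zv zK].
have [|y' [y'H y'v yy']] := toH y _ yv; first by rewrite !inE.
have [|z' [z'H z'v zz']] := toH z _ zv; first by rewrite !inE.
apply: connect_trans yy' (connect_trans (conH _ _ y'H z'H y'v z'v) _).
by rewrite edge_rel_sym.
Qed.

Lemma nonseparable_edge a b : adj a b ->
  nonseparable ([set a; b], [set [set a; b]]).
Proof.
move=> ab; apply/and4P; split.
- apply/andP; split; first by rewrite sub1set; apply/edgesP; exists a, b.
  by apply/forall_inP => f; rewrite inE => /eqP->.
- by apply/set0Pn; exists a; rewrite !inE eqxx.
- apply/sub_connectedP => x y /=.
  have e : connect (edge_rel [set [set a; b]]) a b.
    by apply: connect1; rewrite /edge_rel /= inE.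
  rewrite !inE => /orP[]/eqP-> /orP[]/eqP-> //; rewrite ?connect0 //.
  by rewrite edge_rel_sym.
apply/forallP => v; rewrite /cut_vertex /=; apply/negP => /andP[vab /negP].
apply; apply/sub_connectedP => x y; rewrite !inE => /andP[xv xab] /andP[yv yab].
suff -> : x = y by exact: connect0.
by move: vab xab yab xv yv;
  rewrite !inE => /orP[]/eqP-> /orP[]/eqP-> /orP[]/eqP->;
  rewrite ?eqxx.
Qed.

(** A nonseparable subgraph above H with the largest number of vertices and
    edges. *)
Lemma nonseparable_in_block H :
  nonseparable H -> exists2 B, is_block B & sub_le H B.
Proof.
move=> nH; pose P B := nonseparable B && sub_le H B.
have PH : P H by rewrite /P nH /sub_le !subxx.
case: (@arg_maxnP _ H P (fun B => #|B.1| + #|B.2|) PH) => B /andP[nB HB] maxB.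
exists B => //; split=> // K nK BK.
have HK : sub_le H K.
  case/andP: HB => h1 h2; case/andP: BK => k1 k2.
  by rewrite /sub_le (subset_trans h1 k1) (subset_trans h2 k2).
have := maxB K; rewrite /P nK HK => /(_ isT) /= le.
case/andP: BK => k1 k2; have := subset_leq_card k1; have := subset_leq_card k2.
move=> c2 c1.
have e1 : B.1 == K.1.
  by rewrite eqEcard k1 -(leq_add2r #|K.2|) (leq_trans le) // leq_add2l.
have e2 : B.2 == K.2.
  by rewrite eqEcard k2 -(leq_add2l #|K.1|) (leq_trans le) // leq_add2r.
by case: K {nK k1 k2 HK le c1 c2} e1 e2 => K1 K2 /= /eqP<- /eqP<-; case: (B).
Qed.

End EarsAndBlocks.

(** * Cycles of a cactus *)

Section CactusCycles.

Variable G : sgraph.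
Implicit Types (x y z u v w a b : G) (f : {set G}) (H K B : subgr G).

Record runs_along H (g : nat) (c : nat -> G) : Prop := RunsAlong {
  runs_param :> cycle_param g c;
  runs_vertex : forall v, v \in H.1 <-> exists i, v = c i;
  runs_edge : forall f, f \in H.2 <-> exists i, f = [set c i; c i.+1] }.

Lemma is_cycle_param H : is_cycle H -> exists g c, runs_along H g c.
Proof.
case/existsP=> -[m mG] /existsP[[p /= sp]] /and5P[m2 up cp /eqP H1 /eqP H2].
case ep: p => [|x0 p']; first by rewrite -(eqP sp) ep in m2.
have szp : size p = m by apply/eqP.
pose c i := nth x0 p (i %% m).
have m0 : 0 < m by lia.
have lt i : i %% m < m by rewrite ltn_mod.
have cp_in i : c i \in p by rewrite mem_nth // szp.
have nextc i : next p (c i) = c i.+1.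
  rewrite next_nth cp_in {1}ep index_uniq ?szp // /c -(addn1 i) -modnDml addn1.
  set k := i %% m; have := lt i; rewrite -/k leq_eqVlt => /orP[/eqP e|ltk].
    by rewrite e modnn ep nth_default //; move: szp; rewrite ep /=; lia.
  by rewrite modn_small // ep.
exists m, c; split.
- split=> // [i j|i]; first by rewrite nth_uniq ?szp.
  by rewrite -nextc next_cycle.
- move=> v; rewrite H1 inE; split=> [vp|[i ->] //].
  exists (index v p); rewrite /c modn_small ?nth_index //.
  by rewrite -szp index_mem.
move=> f; rewrite H2; split=> [/imsetP[v vp ->]|[i ->]].
  exists (index v p); rewrite -nextc.
  suff -> : c (index v p) = v by [].
  by rewrite /c modn_small ?nth_index // -szp index_mem.
by rewrite -nextc; apply/imsetP; exists (c i).
Qed.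

Lemma param_path_adj g c k l : cycle_param g c ->
  path (@adj G) (c k) (map c (iota k.+1 l)).
Proof.
by move=> gc; elim: l k => //= l IH k; rewrite (param_adj gc) IH.
Qed.

Lemma param_path_edges (c : nat -> G) k l :
  path_edges (c k) (map c (iota k.+1 l)) =
  [seq [set c i; c i.+1] | i <- iota k l].
Proof. by elim: l k => //= l IH k; rewrite IH. Qed.

Lemma param_last (c : nat -> G) k l :
  last (c k) (map c (iota k.+1 l)) = c (k + l).
Proof. by elim: l k => [|l IH] k /=; rewrite ?addn0 // IH addnS. Qed.

Lemma runs_edge_mem H g c i : runs_along H g c -> [set c i; c i.+1] \in H.2.
Proof. by move=> r; apply/(runs_edge r); exists i. Qed.

(** A cycle is an edge with a path added between its ends. *)
Lemma nonseparable_cycle H g c : runs_along H g c -> nonseparable H.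
Proof.
move=> r; have g2 := param_gt2 r.
have ug : uniq (c 0 :: map c (iota 1 g.-1)).
  rewrite -map_cons -[0 :: _]/(iota 0 g.-1.+1) prednK; last by lia.
  rewrite map_inj_in_uniq ?iota_uniq // => i j; rewrite !mem_iota => ig jg e.
  have [le|le] := leqP i j; first by apply: (param_inj r e); lia.
  by apply/esym; apply: (param_inj r (esym e)); lia.
have lg : last (c 0) (map c (iota 1 g.-1)) = c g.-1 by rewrite param_last.
have gS : c g.-1.+1 = c 0.
  by rewrite prednK -?[in c g](add0n g) ?(param_per _ r) //; lia.
have a0 : adj (c g.-1) (c 0) by rewrite -gS (param_adj r).
have n0 := nonseparable_edge a0.
have small i : exists2 j, j < g & c i = c j /\ c i.+1 = c j.+1.
  have [j [jg e]] := param_rep i 0 r; exists j; first by lia.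
  by split=> //; apply/eqP; rewrite (param_succ _ _ r) e.
set H0 := (_, _) in n0; set p := map c (iota 1 g.-1).
suff -> : H = add_path H0 (c 0) p.
  apply: nonseparable_add_path; rewrite ?lg ?inE ?eqxx ?orbT //.
  exact: (param_path_adj 0 g.-1 r).
rewrite [LHS]surjective_pairing; congr pair; apply/setP.
- move=> v; apply/idP/idP => [/(runs_vertex r)[i ->]|].
    have [j jg [-> _]] := small i; rewrite !inE.
    case: j jg => [|j] jg; first by rewrite eqxx orbT.
    by apply/orP; right; apply: map_f; rewrite mem_iota; lia.
  rewrite !inE => h; apply/(runs_vertex r); case/orP: h => [|/mapP[i _ ->]].
    by case/orP=> /eqP->; [exists g.-1 | exists 0].
  by exists i.
move=> f; rewrite !inE param_path_edges; apply/idP/idP.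
  case/(runs_edge r)=> i ->; have [j jg [-> ->]] := small i.
  have [lt|ge] := ltnP j g.-1.
    by apply/orP; right; apply: map_f; rewrite mem_iota.
  have -> : j = g.-1 by lia.
  by rewrite gS eqxx.
move=> h; apply/(runs_edge r); case/orP: h => [/eqP->|/mapP[i _ ->]].
  by exists g.-1; rewrite gS.
by exists i.
Qed.

(** At a common vertex the two edges of H are edges of K, and K has only two
    edges there; so the walk around K can never leave H. *)
Lemma cycle_in_cycle H K g c g' c' : runs_along H g c -> runs_along K g' c' ->
  sub_le H K -> K.2 \subset H.2.
Proof.
move=> r r' /andP[/subsetP s1 /subsetP s2].
have g2 := param_gt2 r; have g2' := param_gt2 r'.
have step k : c' k \in H.1 -> [set c' k; c' k.+1] \in H.2.
  case/(runs_vertex r) => i ei.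
  (* The index i + (g - 1) stands for the predecessor of i on the cycle. *)
have ipred : c (i + g.-1).+1 = c i by rewrite -addnS prednK ?(param_per _ r)
  //; lia.
  have kpred : c' (k + g'.-1).+1 = c' k.
    by rewrite -addnS prednK ?(param_per _ r') //; lia.
  have at_k f : f \in K.2 -> c' k \in f ->
      f = [set c' k; c' k.+1] \/ f = [set c' (k + g'.-1); c' k].
    case/(runs_edge r') => j ->; rewrite !inE => /orP[] /eqP e.
      left; rewrite e; congr [set _; _]; apply/eqP.
      by rewrite (param_succ _ _ r') e.
    right; rewrite -e; congr [set _; _]; apply/eqP.
    by rewrite -(param_succ _ _ r') -e kpred.
  have m1 := runs_edge_mem i r; have m2 := runs_edge_mem (i + g.-1) r.
  rewrite ipred in m2.
  have [|<- //|e1] := at_k _ (s2 _ m1); first by rewrite ei !inE eqxx.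
  have [|<- //|e2] := at_k _ (s2 _ m2); first by rewrite ei !inE eqxx orbT.
  move: e2; rewrite -e1 setUC => /eq_set2 [[_ e]|[e _]].
    have := param_inj (i := i.+1) (j := i + g.-1) r; rewrite e => /(_ erefl);
      lia.
  have := param_inj (i := i) (j := i.+1) r; rewrite e => /(_ erefl); lia.
have all_in k : c' k \in H.1.
  have [|k0 e0] := (runs_vertex r' (c 0)).1.
    by apply: s1; apply/(runs_vertex r); exists 0.
  have [j [kj ->]] := param_rep k k0 r'; have -> : j = k0 + (j - k0) by lia.
  elim: (j - k0) => [|l IH].
    by rewrite addn0 -e0; apply/(runs_vertex r); exists 0.
  have [i ei] := (runs_edge r _).1 (step _ IH).
  have := set22 (c' (k0 + l)) (c' (k0 + l).+1); rewrite ei !inE addnS.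
  by case/orP => /eqP->; apply/(runs_vertex r); [exists i | exists i.+1].
apply/subsetP => f /(runs_edge r')[k ->]; exact: step.
Qed.

Definition off_edges H : rel G := [rel a b | adj a b && ([set a;
  b] \notin H.2)].

(** Otherwise the connecting path can be added to H, and the result lies in a
    block. That block contains two different edges of H, so it is not a cut
    edge; it is not a cycle either, because that cycle would have no edges
    besides those of H. *)
Lemma off_edges_connect_inj H x y : cactus G -> is_cycle H ->
  x \in H.1 -> y \in H.1 -> connect (off_edges H) x y -> x = y.
Proof.
move=> [_ _ blocks] /is_cycle_param[g [c r]] xH yH /connectP[q].
case/shortenP => p pp up _ ly; have g2 := param_gt2 r.
case: p pp up ly => [//|z p] pp up ly; exfalso.
have padj : path (@adj G) x (z :: p).
  by apply: sub_path pp => a b /andP[].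
have := nonseparable_add_path (nonseparable_cycle r) xH _ padj up.
rewrite -ly => /(_ yH)/nonseparable_in_block[B /blocks bB /andP[s1 s2]].
have HB : sub_le H B.
  by rewrite /sub_le (subset_trans _ s1) ?(subset_trans _ s2) //;
    exact: subsetUl.
have newB : [set x; z] \in B.2.
  by apply: (subsetP s2); rewrite !inE eqxx orbT.
have newH : [set x; z] \notin H.2 by case/andP: pp => /andP[].
case: bB => [[f _ eB]|/is_cycle_param[g' [c' r']]]; last first.
  by move: newH; rewrite (subsetP (cycle_in_cycle r r' HB)).
move: newB (runs_edge_mem 0 r) => newB /(subsetP (andP HB).2).
rewrite eB /= in newB *; move: newB; rewrite !inE => /eqP<- /eqP e.
by move: newH; rewrite -e (runs_edge_mem 0 r).
Qed.

Lemma cactus_connected : cactus G -> forall x y, connect (@adj G) x y.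
Proof.
case=> _ /sub_connectedP con _ x y.
have := con x y (in_setT _) (in_setT _); apply: connect_sub => a b.
case/edgesP => u [v [uv e]]; apply: connect1.
by case: (eq_set2 e) => -[-> ->] //; rewrite adj_sym.
Qed.

(** The gate of w is the vertex of the cycle that w reaches without using
    edges of the cycle. It exists because a path from w to the cycle, stopped
    when it first meets the cycle, uses none of these edges; it is unique by
    off_edges_connect_inj. *)
Lemma cactus_gated_cycle H : cactus G -> is_cycle H ->
  exists gate g c, gated_cycle (G := G) gate g c.
Proof.
move=> cG cH; have [g [c r]] := is_cycle_param cH.
have off_sym : connect_sym (off_edges H).
  by apply: sym_connect_sym => a b; rewrite /off_edges /= adj_sym setUC.
have ex w : exists2 x, x \in H.1 & connect (off_edges H) w x.
  have /connectP[p] := cactus_connected cG w (c 0).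
  elim: p w => [|z p IH] w /=.
    by move=> _ <-; exists (c 0) => //; apply/(runs_vertex r); exists 0.
  case/andP=> wz pz lp; have [wH|wH] := boolP (w \in H.1); first by exists w.
  have [x xH zx] := IH z pz lp; exists x => //.
  apply: connect_trans zx; apply: connect1; rewrite /off_edges /= wz /=.
  apply: contra wH => /(runs_edge r)[i ei].
  have := set21 w z; rewrite ei !inE.
  by case/orP => /eqP->; apply/(runs_vertex r); [exists i | exists i.+1].
pose gate w := odflt w [pick x in H.1 | connect (off_edges H) w x].
have gateP w : gate w \in H.1 /\ connect (off_edges H) w (gate w).
  rewrite /gate; case: pickP => [x /andP[]//|none].
  by have [x xH wx] := ex w; have := none x; rewrite /= xH wx.
have gate_eq w x : x \in H.1 -> connect (off_edges H) w x -> gate w = x.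
  move=> xH wx; have [gH wg] := gateP w.
  apply: (off_edges_connect_inj cG cH gH xH); apply: connect_trans wx.
  by rewrite off_sym.
exists gate, g, c; split; first exact: r.
- by move=> w; have [gH _] := gateP w; apply/(runs_vertex r).
- by move=> i; apply: gate_eq; rewrite ?connect0 //; apply/(runs_vertex r);
  exists i.
move=> u v uv nuv; have [uvH|uvH] := boolP ([set u; v] \in H.2); last first.
  have [gH vg] := gateP v; case/eqP: nuv; apply: gate_eq => //.
  by apply: connect_trans vg; apply: connect1; rewrite /off_edges /= uv.
have [i /eq_set2 [[-> ->]|[-> ->]]] := (runs_edge r _).1 uvH; exists i; auto.
Qed.

End CactusCycles.

(** * Separating a vertex from an edge *)

(** Used to pass from the equality of two sums to the equality of their terms. *)
Lemma leq_sum_tight (I : finType) (P : pred I) (E F : I -> nat) :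
  (forall i, P i -> E i <= F i) ->
  \sum_(i | P i) F i <= \sum_(i | P i) E i -> forall i, P i -> F i = E i.
Proof.
move=> le; rewrite -subn_eq0 => tot i Pi; apply/eqP;
  rewrite eqn_leq le // andbT.
move: tot; rewrite subn_eq0 (bigD1 i) //= [X in _ <= X](bigD1 i) //=.
have : \sum_(j | P j && (j != i)) E j <= \sum_(j | P j && (j != i)) F j.
  by apply: leq_sum => j /andP[/le].
lia.
Qed.

Section VertexEdgeBound.

Variable G : sgraph.
Implicit Types (x y z u v w a b : G) (f : {set G}).

Hypothesis conG : forall x y, connect (@adj G) x y.

(** The first edge of a shortest path from w to f. *)
Lemma separators_step w f : f \in edges G -> w \notin f ->
  exists z, (w, z) \in separators (dist w) (edist f).
Proof.
move=> fE wf; have [z wz e] := edist_descend conG fE wf; exists z.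
by rewrite inE /= wz distxx dist_adj //= e.
Qed.

Lemma sep_notin w f : f \in edges G -> (w \notin f) <= sep (dist w) (edist f).
Proof.
move=> fE; case wf: (w \in f) => //=; move/negbT: wf.
by case/(separators_step fE) => z; exact: sep_gt0.
Qed.

(** The first two edges of a shortest path from w to f separate w from f. *)
Lemma sep_dist2 w f : f \in edges G -> 1 < edist f w ->
  1 < sep (dist w) (edist f).
Proof.
move=> fE f2.
have wf : w \notin f by rewrite -edist_eq0 //; lia.
have [z wz ez] := edist_descend conG fE wf.
have zf : z \notin f by rewrite -edist_eq0 //; lia.
have [t zt et] := edist_descend conG fE zf.
have t2 : 1 < dist w t.
  case: (ltnP 1 (dist w t)) => // le.
  have /orP[] : (dist w t == 0) || (dist w t == 1) by lia.
    by rewrite dist_eq0 => /eqP e; move: et; rewrite -e; lia.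
  move=> /eqP e1; have wt : w != t by rewrite -dist_eq0 e1.
  have [s ts] := dist_descend conG wt.
  rewrite e1 => -[/esym/eqP]; rewrite dist_eq0 => /eqP es.
  by have := edist_step conG fE ts; rewrite -es; lia.
apply: (@sep_two _ _ _ (w, z) (z, t)).
- by rewrite inE /= wz distxx dist_adj //= ez.
- by rewrite inE /= zt dist_adj // t2 et /=.
by rewrite xpair_eqE negb_and adj_neq.
Qed.

(** Each edge avoids all but two of the vertices. *)
Lemma sum_notin : \sum_(w : G) \sum_(f in edges G) (w \notin f) =
  #|edges G| * (#|G| - 2).
Proof.
rewrite exchange_big -sum_nat_const; apply: eq_bigr => f /edgesP[a [b [ab ->]]].
transitivity #|~: [set a; b]|.
  rewrite -sum1_card [RHS]big_mkcond; apply: eq_bigr => w _.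
  by rewrite in_setC; case: (w \notin _).
by rewrite cardsCs setCK cards2 adj_neq.
Qed.

Variables (gate : G -> G) (g : nat).
Implicit Types c : nat -> G.
Let gated := gated_cycle gate g.
Let T := \sum_(w : G) \sum_(f in edges G) sep (dist w) (edist f).

Lemma sep_vertex_gate_edge c w : gated c -> gate w = c 0 ->
  2 <= sep (dist w) (edist [set c 1; c 2]).
Proof.
move=> gc gw; apply: (sep_gate_edge conG gc) => i; exact: (dist_gate conG gc).
Qed.

Lemma cycle_edge_in_edges c i : gated c -> [set c i; c i.+1] \in edges G.
Proof. by move=> gc; apply/edgesP; exists (c i), (c i.+1);
  rewrite (param_adj gc). Qed.

Lemma gate_notin_edge c w : gated c -> gate w = c 0 -> w \notin [set c 1; c 2].
Proof.
move=> gc gw; have g2 := param_gt2 gc; rewrite !inE.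
apply/negP => /orP[]/eqP e; move: gw;
  rewrite e (gated_fix gc) => /esym/(param_inj gc);
  lia.
Qed.

(** The edges c 1 c 2 and c (g - 1) c (g - 2), seen from the gate c 0 of w,
    avoid w and count twice; this adds 2 to the contribution of each w. *)
Lemma vertex_edge_sum_long c0 : gated c0 -> 3 < g ->
  #|edges G| * (#|G| - 2) + 2 * #|G| <= T.
Proof.
move=> gc0 g3; rewrite -sum_notin mulnC -sum_nat_const -big_split /=.
apply: leq_sum => w _; have [c gc gw] := gated_at w gc0.
have [c' gc' e'] := gated_reverse gc.
have gw' : gate w = c' 0.
  by rewrite e' // subn0 gw -[in c g](add0n g) (param_per _ gc).
set f1 := [set c 1; c 2]; set f2 := [set c' 1; c' 2].
have ne : f1 != f2.
  by rewrite /f2 !e'; [apply: set2_neq; apply: (gated_neq gc)| |]; lia.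
have f1E : f1 \in edges G by exact: cycle_edge_in_edges gc.
have f2E : f2 \in edges G by exact: cycle_edge_in_edges gc'.
have -> : 2 = \sum_(f in edges G) (f \in [set f1; f2]).
  transitivity #|[set f1; f2]|; first by rewrite cards2 ne.
  rewrite -sum1_card big_mkcond [RHS]big_mkcond /=; apply: eq_bigr => f _.
  rewrite !inE; case: eqP => [->|_] /=; first by rewrite f1E.
  by case: eqP => [->|_] /=; [rewrite f2E | case: ifP].
rewrite -big_split /=; apply: leq_sum => f fE; rewrite !inE.
have [->|_] := eqVneq f f1.
  by apply: leq_trans (sep_vertex_gate_edge gc gw); case: (_ \notin _).
have [->|_] := eqVneq f f2.
  by apply: leq_trans (sep_vertex_gate_edge gc' gw'); case: (_ \notin _).
by rewrite addn0 sep_notin.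
Qed.

(** The exact value of sep in C0: one when f avoids w, and, if f is the
    triangle edge opposite to the gate of w, one more for the second way
    around the triangle and another one for the path from w to its gate. *)
Definition triangle_sep w f : nat :=
  (w \notin f) +
  ((f \in cycle_edges gate) && (gate w \notin f)) * (gate w != w).+1.

Lemma triangle_sep_leq c0 w f : gated c0 -> g = 3 -> f \in edges G ->
  triangle_sep w f <= sep (dist w) (edist f).
Proof.
move=> gc0 g3 fE; rewrite /triangle_sep.
have [/andP[fC gwf]|_] := boolP (_ && _); last by rewrite addn0 sep_notin.
have [c gc gw] := gated_at w gc0.
have c3 : c 3 = c 0 by rewrite -g3 -[g]add0n (param_per _ gc).
have ef : f = [set c 1; c 2].
  have [k ek] := cycle_edgesP f gc fC; move: gwf; rewrite ek gw.
  have [i [ig ei]] := param_rep k 0 gc.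
  have -> : c k.+1 = c i.+1 by apply/eqP; rewrite (param_succ _ _ gc) ei.
  rewrite ei !inE negb_or; case: i ig {ei} => [|[|[|i]]] //=;
    rewrite ?eqxx // ?c3 ?eqxx ?andbF //.
  by lia.
have wf := gate_notin_edge gc gw; rewrite -ef in wf.
rewrite wf /= mul1n add1n; have [e|ne] := eqVneq (gate w) w.
  by rewrite ef; exact: sep_vertex_gate_edge.
have [z wz] := separators_step fE wf.
have ho : rises_from_gate g c (dist w) by move=> i; exact: (dist_gate conG gc).
have n1 := separators_near conG gc ho.
have n2 : (c 0, c 2) \in separators (dist w) (edist [set c 1; c 2]).
  by rewrite -c3; apply: (separators_far conG gc ho); rewrite g3.
rewrite -ef in n1 n2.
have <- : #|[set (w, z); (c 0, c 1); (c 0, c 2)]| = 3.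
  rewrite setUC cardsU1 cards2 !inE !xpair_eqE !eqxx /= -gw (negPf ne) /=.
  rewrite [w == _]eq_sym (negPf ne) /=.
  by rewrite eq_sym (negPf (gated_neq (i := 1) (j := 2) gc _)) // ; lia.
apply/subset_leq_card/subsetP => d; rewrite !in_setU !in_set1.
by case/orP => [/orP[]|] /eqP ->.
Qed.

Lemma sum_triangle_sep c0 : gated c0 -> g = 3 ->
  #|edges G| * (#|G| - 2) + (2 * #|G| - 3) <=
  \sum_(w : G) \sum_(f in edges G) triangle_sep w f.
Proof.
move=> gc0 g3; under [leqRHS]eq_bigr => w _ do rewrite big_split.
rewrite big_split /= sum_notin leq_add2l.
have -> : 2 * #|G| - 3 = \sum_(w : G) (gate w != w).+1.
  have -> : \sum_(w : G) (gate w != w).+1 = #|G| + #|[set w | gate w != w]|.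
    under eq_bigr => w _ do rewrite -add1n.
    rewrite big_split /= sum1_card; congr (_ + _).
    rewrite -sum1dep_card [RHS]big_mkcond; apply: eq_bigr => w _.
    by case: (gate w != w).
  have := cardsID [set w | gate w == w] [set: G].
  rewrite setTI setTD cardsT (card_cycle_vertices gc0) g3.
  have -> : ~: [set w | gate w == w] = [set w | gate w != w].
    by apply/setP => w; rewrite !inE.
  lia.
apply: leq_sum => w _; have [c gc gw] := gated_at w gc0.
rewrite (bigD1 [set c 1; c 2]) /=; last exact: cycle_edge_in_edges.
have -> : [set c 1; c 2] \in cycle_edges gate.
  by apply/(cycle_edgesP _ gc); exists 1.
have -> /= : gate w \notin [set c 1; c 2].
  by apply: (gate_notin_edge gc); rewrite gw (gated_fix gc).
by rewrite mul1n leq_addr.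
Qed.

End VertexEdgeBound.

(** * Lower bounds and their equality cases *)

(** The shape of C0, with a as the centre. *)
Definition star_triangle (G : sgraph) (a b c : G) : Prop :=
  uniq [:: a; b; c] /\
  forall u v, adj u v = (u != v) &&
    [|| u == a, v == a | (u \in [:: a; b; c]) && (v \in [:: a; b; c])].

Section Tight.

Variable G : sgraph.
Implicit Types (x y z u v w a b : G) (f : {set G}).

Hypothesis conG : forall x y, connect (@adj G) x y.

Variables (gate : G -> G) (g : nat).
Implicit Types c : nat -> G.
Let gated := gated_cycle gate g.

Local Notation C := (cycle_edges gate).

Lemma off_cycle_edge_gate f w w' : f \in edges G :\: C ->
  w \in f -> w' \in f -> gate w = gate w'.
Proof.
case/off_cycle_edgeP=> a [b [_ -> e]].
by rewrite !inE => /orP[]/eqP-> /orP[]/eqP->.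
Qed.

Lemma sep_disjoint_edges f f' : f \in edges G -> f' \in edges G ->
  [disjoint f & f'] -> 0 < sep (edist f) (edist f').
Proof.
move=> fE f'E dis.
have [a af amin] : exists2 a, a \in f & forall b, b \in f -> edist f' a <=
  edist f' b.
  have [a [b [_ ef]]] := edgesP _ fE.
  have [le|le] := leqP (edist f' a) (edist f' b); [exists a | exists b];
    rewrite ?ef ?inE ?eqxx ?orbT // => x; rewrite !inE => /orP[]/eqP-> //.
  exact: ltnW.
have af' : a \notin f' by rewrite (disjointFr dis af).
have [z az ez] := edist_descend conG f'E af'.
apply: (@sep_gt0 _ _ _ (a, z)); rewrite inE /= az ez ltnSn andbT.
have /eqP -> : edist f a == 0 by rewrite edist_eq0.
by rewrite lt0n edist_eq0 //; apply/negP => /amin; rewrite ez ltnn.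
Qed.

(** The conclusion is vacuous when the graph is just its cycle; otherwise c' 0
    is the gate of any edge off the cycle. *)
Lemma off_cycle_common_vertex c : gated c ->
  (forall f w, f \in edges G :\: C -> w \in f -> gate w \in f) ->
  (forall f f' w w', f \in edges G :\: C -> f' \in edges G :\: C ->
     w \in f -> w' \in f' -> gate w = gate w') ->
  exists2 c', gated c' & forall f, f \in edges G :\: C -> c' 0 \in f.
Proof.
move=> gc inC same; have [O0|[f0 f0O]] := set_0Vmem (edges G :\: C).
  by exists c => // f; rewrite O0 inE.
have [a [b [_ ef _]]] := off_cycle_edgeP f0O.
have af0 : a \in f0 by rewrite ef !inE eqxx.
have [c' gc' ga] := gated_at a gc; exists c' => // f fO.
have [x [y [_ e _]]] := off_cycle_edgeP fO.
have xf : x \in f by rewrite e !inE eqxx.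
by rewrite -ga (same _ _ _ _ f0O fO af0 xf) inC.
Qed.

(** A vertex other than c 0 that lies off the cycle is on some edge, which is
    off the cycle and therefore contains c 0. *)
Lemma star_triangle_gated c : gated c -> g = 3 ->
  (forall f, f \in edges G :\: C -> c 0 \in f) ->
  star_triangle (c 0) (c 1) (c 2).
Proof.
move=> gc g3 hO.
have fixed u : (u \in [:: c 0; c 1; c 2]) = (gate u == u).
  apply/idP/eqP => [|e]; first by rewrite !inE => /or3P[]/eqP->;
    rewrite (gated_fix gc).
  have [k ek] := gated_onto gc u; have [i [ig ei]] := param_rep k 0 gc.
  rewrite -e ek ei !inE; case: i ig {ei} => [|[|[|i]]];
    rewrite ?eqxx ?orbT //; lia.
have c3 : c 3 = c 0 by rewrite -g3 -[g]add0n (param_per _ gc).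
have a01 := param_adj gc 0; have a12 := param_adj gc 1.
have a20 := param_adj gc 2; rewrite c3 in a20.
split.
  rewrite /= !inE !negb_or (adj_neq a01) (adj_neq a12) /= eq_sym.
  by rewrite (adj_neq a20).
move=> u v; rewrite !fixed; apply/idP/idP.
  move=> uv; rewrite adj_neq //=; have [guv|ne] := eqVneq (gate u) (gate v).
    have : c 0 \in [set u; v].
      apply: hO; rewrite inE; apply/andP; split; last by apply/edgesP;
        exists u, v.
      apply/imsetP => -[[x y]]; rewrite inE /= => /andP[_ nxy].
      by case/eq_set2 => -[ex ey]; rewrite -ex -ey guv eqxx in nxy.
    by rewrite !inE ![c 0 == _]eq_sym => /orP[]->; rewrite ?orbT.
  have [i [] [-> ->]] := gated_edge gc uv ne;
    rewrite !(gated_fix gc) !eqxx !orbT //.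
case/andP => ne.
have both x y : x != y -> gate x == x -> gate y == y -> adj x y.
  rewrite -!fixed !inE => nxy /or3P[]/eqP ex /or3P[]/eqP ey; move: nxy;
    rewrite ex ey ?eqxx // => _; by rewrite // adj_sym.
have to_a v' : c 0 != v' -> adj (c 0) v'.
  move=> nv; have [fv|nfv] := boolP (gate v' == v').
    by apply: both => //; rewrite (gated_fix gc).
  have [z vz _] := dist_descend conG nv.
  have : c 0 \in [set v'; z].
    apply: hO; rewrite inE; apply/andP; split; last by apply/edgesP;
      exists v', z.
    apply/negP => /(cycle_edgesP _ gc)[i ei].
    have := set21 v' z; rewrite ei !inE => /orP[]/eqP ev;
      by rewrite ev (gated_fix gc) eqxx in nfv.
  by rewrite !inE (negPf nv) /= => /eqP->; rewrite adj_sym.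
case/or3P => [/eqP e|/eqP e|/andP[]]; last exact: both.
  by rewrite e; apply: to_a; rewrite -e.
by rewrite e adj_sym; apply: to_a; rewrite -e eq_sym.
Qed.

Lemma Sz_e_geq c : gated c -> 4 < #|G| -> 4 * #|G| <= 2 * Sz_e G + 6.
Proof.
move=> gc n5; have := Sz_e_cycle_leq conG gc; have := leq_card_edges conG gc.
have := param_gt2 gc.
by have [->|ne] := eqVneq g 3; have [lt|le] := ltnP 4 g; lia.
Qed.

(** Equality leaves no room for a separation between two edges off the
    triangle, so any two of them meet, and this gives them a common gate. If
    such an edge missed its gate c 0, it would be separated from c 0 c 1 in
    addition to the two separations from c 1 c 2. *)
Lemma Sz_e_tight c : gated c -> 4 < #|G| -> 2 * Sz_e G + 6 = 4 * #|G| ->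
  exists a b d, @star_triangle G a b d.
Proof.
move=> gc n5 tight; have mn := leq_card_edges conG gc; have g2 := param_gt2 gc.
have g3 : g = 3.
  have := Sz_e_cycle_leq conG gc.
  by have [//|ne] := eqVneq g 3; have [lt|le] := ltnP 4 g; lia.
have cO : #|edges G :\: C| = #|edges G| - 3.
  by rewrite cardsD (setIidPr (cycle_edges_sub gate)) (card_cycle_edges gc) g3.
have sO f : f \in edges G :\: C ->
    2 <= \sum_(f' in C) sep (edist f) (edist f').
  by move/(sum_sep_off_cycle conG gc); rewrite g3.
have sC : 6 <= \sum_(f in C) \sum_(f' in C) sep (edist f) (edist f').
  have -> : 6 = #|C| * 2 by rewrite (card_cycle_edges gc) g3.
  rewrite -sum_nat_const; apply: leq_sum => f.
  by move/(sum_sep_on_cycle conG gc); rewrite g3.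
have sO2 : (#|edges G| - 3) * 2 <=
    \sum_(f in edges G :\: C) \sum_(f' in C) sep (edist f) (edist f').
  by rewrite -cO -sum_nat_const; apply: leq_sum.
have split := Sz_e_split gate.
have OO : \sum_(f in edges G :\: C) \sum_(f' in edges G :\: C)
    sep (edist f) (edist f') = 0 by lia.
have sO2' : \sum_(f in edges G :\: C) \sum_(f' in C) sep (edist f) (edist f')
    <= (#|edges G| - 3) * 2 by lia.
have O2 f : f \in edges G :\: C -> \sum_(f' in C) sep (edist f) (edist f') = 2.
  by apply: (leq_sum_tight sO); rewrite sum_nat_const cO.
have meet f f' : f \in edges G :\: C -> f' \in edges G :\: C ->
    ~~ [disjoint f & f'].
  move=> fO f'O; apply/negP => /sep_disjoint_edges.
  have -> : sep (edist f) (edist f') = 0.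
    move/eqP: OO; rewrite sum_nat_eq0 => /forall_inP/(_ f fO).
    by rewrite sum_nat_eq0 => /forall_inP/(_ f' f'O)/eqP.
  by move: fO f'O; rewrite !inE => /andP[_ ->] /andP[_ ->] /(_ isT isT).
have [||c' gc' hc'] := off_cycle_common_vertex gc.
- move=> f w fO wf; apply: contraT => gf.
  have [c' gc' gw] := gated_at w gc.
  have fE : f \in edges G by move: fO; rewrite inE => /andP[].
  have rises : rises_from_gate g c' (edist f).
    have [a [b [_ ef _]]] := off_cycle_edgeP fO.
    have h x : x \in f -> gate x = c' 0.
      by move=> xf; rewrite -gw; exact: off_cycle_edge_gate fO _ _.
    move=> i ig; rewrite ef; apply: (edist_gate conG gc') => //; apply: h;
      by rewrite ef !inE eqxx ?orbT.
  have inC i : [set c' i; c' i.+1] \in C by apply/(cycle_edgesP _ gc');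
    exists i.
  have dis : [disjoint f & [set c' 0; c' 1]].
    rewrite disjoint_sym; apply/pred0P => x /=; apply/negP => /andP[].
    rewrite !inE => /orP[]/eqP-> xf; first by rewrite -gw (negPf gf) in xf.
    have := off_cycle_edge_gate fO wf xf; rewrite gw (gated_fix gc').
    by move/(param_inj gc'); lia.
  have := leq_sum_two (fun f' => sep (edist f) (edist f')) (inC 1) (inC 0) _.
  rewrite (O2 _ fO) => /=.
  have := sep_gate_edge conG gc' rises.
  have := sep_disjoint_edges fE (subsetP (cycle_edges_sub gate) _ (inC 0)) dis.
  have ne : [set c' 1; c' 2] != [set c' 0; c' 1].
    rewrite setUC; apply: set2_neq; last by rewrite eq_sym;
      apply: (gated_neq gc'); lia.
    by rewrite eq_sym; apply: (gated_neq gc'); lia.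
  by rewrite ne => ? ? /(_ isT); lia.
- move=> f f' w w' fO f'O wf wf'; have := meet _ _ fO f'O.
  case/pred0Pn => v /andP[vf vf'].
  by rewrite (off_cycle_edge_gate fO wf vf) (off_cycle_edge_gate f'O vf' wf').
by exists (c' 0), (c' 1), (c' 2); apply: star_triangle_gated.
Qed.

Lemma vertex_edge_sum_geq c : gated c ->
  #|G| ^ 2 <= \sum_(w : G) \sum_(f in edges G) sep (dist w) (edist f) + 3.
Proof.
move=> gc; have mn := leq_card_edges conG gc; have g2 := param_gt2 gc.
have gn : g <= #|G| by rewrite -(card_cycle_vertices gc) max_card.
have le : #|G| * (#|G| - 2) <= #|edges G| * (#|G| - 2) by rewrite leq_mul.
have n2 : #|G| ^ 2 = #|G| * (#|G| - 2) + 2 * #|G|.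
  by rewrite expnS expn1 [2 * _]mulnC -mulnDr subnK //; lia.
have [lt|le3] := ltnP 3 g; first by have := vertex_edge_sum_long conG gc lt;
  lia.
have g3 : g = 3 by lia.
have := sum_triangle_sep gc g3.
have : \sum_(w : G) \sum_(f in edges G) triangle_sep gate w f <=
    \sum_(w : G) \sum_(f in edges G) sep (dist w) (edist f).
  by apply: leq_sum => w _; apply: leq_sum => f;
    exact: (triangle_sep_leq conG _ gc g3).
lia.
Qed.

(** Equality makes sep equal to triangle_sep, so that an edge f off the
    triangle is separated at most once from each vertex, and by sep_dist2 no
    vertex is at distance 2 or more from f. If f missed its gate c 0, then c 1
    would be; if two edges off the triangle had different gates, an end of one
    of them would be at distance at least 2 from the other. *)
Lemma vertex_edge_sum_tight c : gated c ->
  \sum_(w : G) \sum_(f in edges G) sep (dist w) (edist f) + 3 = #|G| ^ 2 ->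
  exists a b d, @star_triangle G a b d.
Proof.
move=> gc tight; have mn := leq_card_edges conG gc; have g2 := param_gt2 gc.
have gn : g <= #|G| by rewrite -(card_cycle_vertices gc) max_card.
have le : #|G| * (#|G| - 2) <= #|edges G| * (#|G| - 2) by rewrite leq_mul.
have n2 : #|G| ^ 2 = #|G| * (#|G| - 2) + 2 * #|G|.
  by rewrite expnS expn1 [2 * _]mulnC -mulnDr subnK //; lia.
have g3 : g = 3.
  have [lt|] := ltnP 3 g; last by lia.
  by have := vertex_edge_sum_long conG gc lt; lia.
have row w : true -> \sum_(f in edges G) triangle_sep gate w f <=
    \sum_(f in edges G) sep (dist w) (edist f).
  by move=> _; apply: leq_sum => f; exact: (triangle_sep_leq conG _ gc g3).
have sepE w f : f \in edges G -> sep (dist w) (edist f) = triangle_sep gate w f.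
  move: f; apply: leq_sum_tight => [f' f'E|];
    first exact: (triangle_sep_leq conG _ gc g3).
  rewrite (leq_sum_tight row) //; have := sum_triangle_sep gc g3; lia.
have near f w : f \in edges G :\: C -> edist f w <= 1.
  move=> fO; have fE : f \in edges G by move: fO; rewrite inE => /andP[].
  rewrite leqNgt; apply/negP => /(sep_dist2 conG fE); rewrite sepE //.
  move: fO; rewrite /triangle_sep inE => /andP[/negPf-> _].
  by case: (_ \notin _).
have inC f w : f \in edges G :\: C -> w \in f -> gate w \in f.
  move=> fO wf; have fE : f \in edges G by move: fO; rewrite inE => /andP[].
  rewrite -edist_eq0 // -leqn0 -ltnS.
  have [c' gc' gw] := gated_at w gc.
  have [a [b [_ ef _]]] := off_cycle_edgeP fO.
  have h x : x \in f -> gate x = c' 0.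
    by move=> xf; rewrite -gw; exact: off_cycle_edge_gate fO _ _.
  have := near f (c' 1) fO; rewrite gw ef (edist_gate conG gc' (i := 1)).
  - by lia.
  - by apply: h; rewrite ef !inE eqxx.
  - by apply: h; rewrite ef !inE eqxx orbT.
  by lia.
have [|c' gc' hc'] := off_cycle_common_vertex gc inC.
- move=> f f' w w' fO f'O wf wf'; apply/eqP; apply: contraT => ne.
  have [u uf gu] : exists2 u, u \in f & gate u != u.
    have [a [b [ab ef e]]] := off_cycle_edgeP fO.
    have [ga|] := eqVneq (gate a) a; last by exists a => //;
      rewrite ef !inE eqxx.
    exists b; first by rewrite ef !inE eqxx orbT.
    by rewrite -e ga adj_neq.
  have f'E : f' \in edges G by move: f'O; rewrite inE => /andP[].
  have gne v : v \in f' -> gate u != gate v.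
    move=> vf'; rewrite (off_cycle_edge_gate fO uf wf).
    by rewrite (off_cycle_edge_gate f'O vf' wf').
  have uf' : u \notin f' by apply/negP => /gne; rewrite eqxx.
  have [z uz ez] := edist_descend conG f'E uf'.
  have zf' : z \in f' by rewrite -edist_eq0 // -leqn0 -ltnS -ez near.
  have [i [] [e e']] := gated_edge gc uz (gne z zf').
    by rewrite e (gated_fix gc) eqxx in gu.
  by rewrite e' (gated_fix gc) eqxx in gu.
by exists (c' 0), (c' 1), (c' 2); apply: star_triangle_gated.
Qed.

End Tight.

(** * The graphs isomorphic to C0 *)

(** List a, b, c first and then the other vertices; the position in this list
    is the isomorphism. *)
Lemma star_triangle_iso n (G : sgraph) (a b c : G) :
  star_triangle a b c -> #|G| = n -> graph_iso G (C0 n).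
Proof.
move=> [uabc adjE] cG; pose r := [:: a; b; c].
pose s := r ++ [seq x <- enum G | x \notin r].
have us : uniq s.
  rewrite cat_uniq uabc filter_uniq ?enum_uniq // andbT.
  by apply/hasPn => x; rewrite mem_filter => /andP[].
have ins x : x \in s by rewrite mem_cat mem_filter mem_enum andbT orbN.
have ss : size s = n.
  by rewrite -cG -(card_uniqP us); apply: eq_card => x; rewrite ins.
have lt x : index x s < n by rewrite -ss index_mem.
have lt3 x : (index x s <= 2) = (x \in r).
  rewrite index_cat; case: ifP => xr; first by rewrite -ltnS -index_mem in xr *.
  by rewrite addSn.
have eq0 x : (index x s == 0) = (x == a) by rewrite /s /= [x == a]eq_sym;
  case: (a == x).
pose f x := Ordinal (lt x).
have finj : injective f by move=> x y /(congr1 val) /= e;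
  apply: (index_inj (s := s) x) e.
exists f; first by apply: inj_card_bij => //; rewrite card_ord cG.
move=> x y; rewrite adjE -/r -!lt3 -!eq0 -(inj_eq finj).
by [].
Qed.

Lemma iso_star_triangle n (G : sgraph) : 2 < n -> graph_iso G (C0 n) ->
  exists a b c : G, star_triangle a b c.
Proof.
move=> n2 [f [h hK fK] fadj].
pose i0 : C0 n := Ordinal (ltnW (ltnW n2)).
pose i1 : C0 n := Ordinal (ltnW n2); pose i2 : C0 n := Ordinal n2.
have feq x i : (f x == i) = (x == h i) by rewrite -(inj_eq (can_inj hK)) fK.
have hinj := can_inj fK.
exists (h i0), (h i1), (h i2); split.
  by rewrite /= !inE !(inj_eq hinj).
have in3 x : (x \in [:: h i0; h i1; h i2]) = (val (f x) <= 2).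
  rewrite !inE -!feq -!val_eqE /=; lia.
move=> u v; rewrite -fadj !in3 -(inj_eq (can_inj hK)) -![_ == h i0]feq.
by [].
Qed.

Section StarTriangle.

Variables (G : sgraph) (a b c : G).
Implicit Types (x y z u v w : G) (f : {set G}).

Hypothesis star : star_triangle a b c.

(** Lets every estimate for b be used for c. *)
Lemma star_triangle_sym : star_triangle a c b.
Proof.
case: star => /= /and3P[]; rewrite !inE !negb_or => /andP[ab ac] bc _ adjE.
split; first by rewrite /= !inE negb_or ac ab eq_sym bc.
move=> u v; rewrite adjE !inE.
by rewrite [(u == b) || _]orbC [(v == b) || _]orbC.
Qed.

Lemma star_dart_sum (A : G -> G -> nat) :
  dart_sum A = A a b + A a c + A b a + A c a + A b c + A c b +
     \sum_(l | l \notin [:: a; b; c]) (A a l + A l a).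
Proof.
case: star => /= /and3P[]; rewrite !inE !negb_or => /andP[ab ac] bc _ adjE.
have ba : b != a by rewrite eq_sym. have ca : c != a by rewrite eq_sym.
have cb : c != b by rewrite eq_sym.
have aE v : adj a v = (v != a) by rewrite adjE eqxx /= eq_sym andbT.
have bE v : adj b v = (v == a) || (v == c).
  rewrite adjE !inE eqxx !orbT (negPf ba) /= [b == v]eq_sym.
  have [->|_] := eqVneq v b; first by rewrite (negPf ba) (negPf bc).
  by case: (v == a).
have cE v : adj c v = (v == a) || (v == b).
  rewrite adjE !inE eqxx !orbT (negPf ca) /= [c == v]eq_sym.
  have [->|_] := eqVneq v c; first by rewrite (negPf ca) (negPf cb).
  by rewrite orbF; case: (v == a).
have lE l v : l \notin [:: a; b; c] -> adj l v = (v == a).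
  move=> lr; rewrite adjE (negPf lr) /= orbF; move: lr.
  rewrite !inE !negb_or => /and3P[la _ _]; rewrite (negPf la) /=.
  by case: (eqVneq v a) => [->|]; rewrite ?la ?andbF.
have split3 (F : G -> nat) : \sum_u F u =
    F a + (F b + (F c + \sum_(u | (u != a) && (u != b) && (u != c)) F u)).
  by rewrite (bigD1 a) //= (bigD1 b) //= (bigD1 c) //= ca cb.
rewrite /dart_sum split3.
have -> : \sum_(v | adj a v) A a v = A a b + (A a c +
  \sum_(l | l \notin [:: a; b; c]) A a l).
  rewrite (bigD1 b) ?aE //= (bigD1 c) ?aE ?ca //=; congr (_ + (_ + _)).
  by apply: eq_bigl => l; rewrite aE !inE !negb_or -andbA.
have two x y (F : G -> nat) :
  x != y -> \sum_(v | (v == x) || (v == y)) F v = F x + F y.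
  move=> xy; rewrite (bigD1 x) ?eqxx //= (bigD1 y) /=;
    last by rewrite eqxx orbT eq_sym.
  by rewrite big1 ?addn0 // => v; case: (v == x); case: (v == y).
under [X in _ + (X + _)]eq_bigl => v do rewrite bE.
under [X in _ + (_ + (X + _))]eq_bigl => v do rewrite cE.
rewrite !two // big_split /=.
have -> : \sum_(u | (u != a) && (u != b) && (u != c)) \sum_(v | adj u v) A u v =
    \sum_(l | l \notin [:: a; b; c]) A l a.
  apply: eq_big => u; first by rewrite !inE !negb_or andbA.
  move=> hu; rewrite (big_pred1 a) // => v; apply: lE.
  by rewrite !inE !negb_or andbA.
have arith (i j k l m n p q : nat) : i + (j + p) + (k + l + (m + n + q)) =
    i + j + k + m + l + n + (p + q) by lia.
exact: arith.
Qed.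

Lemma star_card_leaves : #|[pred l | l \notin [:: a; b; c]]| = #|G| - 3.
Proof.
case: star => u _; have <- : #|[:: a; b; c]| = 3 by rewrite (card_uniqP u).
by rewrite -[#|G|](cardC (mem [:: a; b; c])) addKn; apply: eq_card => x;
  rewrite !inE.
Qed.

Lemma star_distinct : [/\ a != b, a != c & b != c].
Proof.
by case: star => /= /and3P[]; rewrite !inE !negb_or => /andP[ab ac] bc _ _.
Qed.

Lemma star_adj_center x : x != a -> adj a x.
Proof. by case: star => _ -> xa; rewrite eqxx andbT eq_sym. Qed.

Lemma star_adj_base : adj b c.
Proof.
have [_ _ bc] := star_distinct.
by case: star => _ ->; rewrite bc !inE !eqxx !orbT.
Qed.

Lemma star_edge_cases f : f \in edges G -> a \in f \/ f = [set b; c].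
Proof.
case: star => _ adjE /edgesP[u [v [uv ->]]]; rewrite !inE ![a == _]eq_sym.
have [_|ua] := eqVneq u a; first by left.
have [_|va] := eqVneq v a; first by left.
move: uv; rewrite adjE !inE (negPf ua) (negPf va) /= => /andP[uv].
by case/andP=> /orP[]/eqP eu /orP[]/eqP ev; move: uv;
  rewrite eu ev ?eqxx // => _;
  right; rewrite // setUC.
Qed.

Lemma star_card_edges : #|edges G| <= #|G|.
Proof.
pose P := [set [set a; x] | x in ~: [set a]].
have sub : edges G \subset [set b; c] |: P.
  apply/subsetP => f fE; rewrite in_setU1; have [af|->] := star_edge_cases fE;
    last by rewrite eqxx.
  case/edgesP: fE af => u [v [uv ->]]; rewrite !inE => /orP[] /eqP e;
    apply/orP; right.
    by apply/imsetP; exists v; rewrite ?inE e // eq_sym adj_neq.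
  by apply/imsetP; exists u; rewrite ?inE e ?adj_neq // setUC.
apply: leq_trans (subset_leq_card sub) _.
apply: leq_trans (leq_card_setU _ _) _.
have : #|P| <= #|~: [set a]| by exact: leq_imset_card.
have n0 : 0 < #|G| by apply/card_gt0P; exists a.
by rewrite cards1 cardsC1 add1n => le; rewrite (leq_ltn_trans le) ?ltn_predL.
Qed.

Lemma star_dist_center w : dist a w <= 1.
Proof.
have [->|ne] := eqVneq w a; first by rewrite distxx.
by rewrite dist_adj ?star_adj_center.
Qed.

Lemma star_nv_center u : nv u a <= 1.
Proof.
have -> : 1 = #|[set u]| by rewrite cards1.
apply/subset_leq_card/subsetP => w; rewrite !inE => lt.
by rewrite eq_sym -dist_eq0; have := star_dist_center w; lia.
Qed.

Lemma star_nv_to_base : nv a b <= #|G| - 2.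
Proof.
have [ab ac bc] := star_distinct.
have -> : #|G| - 2 = #|~: [set b; c]| by rewrite cardsCs setCK cards2 bc.
apply/subset_leq_card/subsetP => w; rewrite !inE negb_or => lt.
apply/andP; split; apply: contraTneq lt => ->; first by rewrite distxx.
by rewrite !dist_adj ?star_adj_base ?star_adj_center // eq_sym.
Qed.

Hypothesis conG : forall x y, connect (@adj G) x y.

Lemma star_nv_base : nv b c <= 1.
Proof.
have [ab ac bc] := star_distinct.
have -> : 1 = #|[set b]| by rewrite cards1.
apply/subset_leq_card/subsetP => w; rewrite !inE => lt.
apply: contraTT lt; rewrite eq_sym -leqNgt => bw.
have [->|wa] := eqVneq w a.
  by rewrite !dist_adj // adj_sym star_adj_center // eq_sym.
have [->|wc] := eqVneq w c; first by rewrite distxx.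
have : dist c w <= 2.
  apply: leq_trans (dist_step conG c (star_adj_center wa)) _.
  by rewrite dist_adj // adj_sym star_adj_center // eq_sym.
move/leq_trans; apply; rewrite ltnNge; apply/negP => b1.
have [z wz ez] := dist_descend conG bw.
have /eqP ezb : b == z by rewrite -dist_eq0; lia.
case: star => _ adjE; move: wz; rewrite -ezb adjE !inE (negPf wa) (negPf wc).
by rewrite [b == a]eq_sym (negPf ab) eqxx /= orbF andbT eq_sym andNb.
Qed.

Lemma closer_notin f u v : f \in edges G -> edist f u < edist f v -> v \notin f.
Proof. by move=> fE lt; rewrite -edist_eq0 //; lia. Qed.

Lemma star_edist_center f : f \in edges G -> edist f a <= 1.
Proof.
move=> fE; have [af|->] := star_edge_cases fE.
  by have /eqP -> : edist f a == 0 by rewrite edist_eq0.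
have [ab _ _] := star_distinct;
  rewrite edist_set2 (@dist_adj _ b a) ?geq_minl //.
by rewrite adj_sym star_adj_center // eq_sym.
Qed.

(** An edge closer to u than to the centre avoids the centre, so it can only
    be bc. In particular me vanishes at the leaves. *)
Lemma star_me_center u : me u a <= (u \in [set b; c]).
Proof.
have sub f : f \in edges G -> edist f u < edist f a -> f = [set b;
  c] /\ u \in f.
  move=> fE lt; have [af|->] := star_edge_cases fE.
    by move: (closer_notin fE lt); rewrite af.
  split=> //; have [af|e] := star_edge_cases fE.
    by move: (closer_notin fE lt); rewrite af.
  by rewrite -e -edist_eq0 //; have := star_edist_center fE; lia.
rewrite /me; have [ubc|ubc] := boolP (u \in _).
  have -> : nat_of_bool true = #|[set [set b; c]]| by rewrite cards1.
  apply/subset_leq_card/subsetP => f;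
    rewrite inE => /andP[fE /(sub f fE)[-> _]].
  by rewrite inE.
rewrite leqn0 cards_eq0; apply/eqP/setP => f; rewrite !inE; apply/negP.
by case/andP=> fE /(sub f fE)[-> ]; rewrite (negPf ubc).
Qed.

Lemma star_me_base : me b c <= 1.
Proof.
have [ab ac bc] := star_distinct.
have -> : 1 = #|[set [set a; b]]| by rewrite cards1.
apply/subset_leq_card/subsetP => f; rewrite inE => /andP[fE lt]; rewrite inE.
have cf := closer_notin fE lt.
have af : a \in f.
  by have [//|e] := star_edge_cases fE; rewrite e !inE eqxx orbT in cf.
have bf : b \in f.
  rewrite -edist_eq0 //;
    have := edist_step conG fE (star_adj_center _ : adj a c).
  have /eqP -> : edist f a == 0 by rewrite edist_eq0.
  by rewrite eq_sym => /(_ ac); lia.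
case/edgesP: fE af bf => u [v [uv ->]]; rewrite !inE.
by move=> /orP[]/eqP ea /orP[]/eqP eb; move: ab; rewrite ea eb ?eqxx // => _;
  rewrite setUC.
Qed.

Lemma star_me_to_base : me a b <= #|G| - 2.
Proof.
have [ab ac bc] := star_distinct.
pose D := [set [set a; b]; [set b; c]].
have DE : D \subset edges G.
  apply/subsetP => f; rewrite !inE => /orP[]/eqP->; apply/edgesP.
    by exists a, b; rewrite star_adj_center // eq_sym.
  by exists b, c; rewrite star_adj_base.
have cD : #|D| = 2.
  by rewrite cards2 set2_neq // setUC.
apply: leq_trans (_ : #|edges G :\: D| <= _).
  apply/subset_leq_card/subsetP => f; rewrite inE => /andP[fE lt].
  rewrite inE fE andbT; apply: contra (closer_notin fE lt).
  by rewrite !inE => /orP[]/eqP->; rewrite !inE eqxx ?orbT.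
by rewrite cardsD (setIidPr DE) cD leq_sub2r // star_card_edges.
Qed.

Lemma star_me_to_leaf l : l != a -> me a l <= #|G| - 1.
Proof.
move=> la; have alE : [set a; l] \in edges G.
  by apply/edgesP; exists a, l; rewrite star_adj_center.
apply: leq_trans (_ : #|edges G :\ [set a; l]| <= _).
  apply/subset_leq_card/subsetP => f; rewrite inE => /andP[fE lt].
  rewrite in_setD1 fE andbT; apply: contraNneq (closer_notin fE lt) => ->.
  by rewrite !inE eqxx orbT.
have -> : #|edges G :\ [set a; l]| = #|edges G| - 1.
  by rewrite [in RHS](cardsD1 [set a; l]) alE add1n subn1.
by rewrite leq_sub2r // star_card_edges.
Qed.

End StarTriangle.

Lemma star_Sz_e_leq (G : sgraph) (a b c : G) :
  (forall x y, connect (@adj G) x y) -> star_triangle a b c -> 2 < #|G| ->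
  2 * Sz_e G + 6 <= 4 * #|G|.
Proof.
move=> conG st n2; have st' := star_triangle_sym st.
have leaves : \sum_(l | l \notin [:: a; b;
  c]) (me a l * me l a + me l a * me a l) = 0.
  apply: big1 => l lr; have := star_me_center st l; move: lr;
    rewrite !inE !negb_or.
  case/and3P=> _ /negPf-> /negPf-> /=; rewrite leqn0 => /eqP->.
  by rewrite muln0.
rewrite Sz_e_dart (star_dart_sum st) leaves addn0.
have h1 := star_me_center st b; have h2 := star_me_center st c.
rewrite !inE !eqxx ?orbT in h1 h2.
have h3 := star_me_to_base st; have h4 := star_me_to_base st'.
have h5 := star_me_base st conG; have h6 := star_me_base st' conG.
have p x y k : x <= k -> y <= 1 -> x * y <= k.
  by move=> xk y1; rewrite -[k]muln1 leq_mul.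
have := p _ _ _ h3 h1; have := p _ _ _ h4 h2; have := p _ _ _ h5 h6.
rewrite ![me b a * _]mulnC ![me c a * _]mulnC ![me c b * _]mulnC; lia.
Qed.

Lemma star_vertex_edge_sum_leq (G : sgraph) (a b c : G) :
  (forall x y, connect (@adj G) x y) -> star_triangle a b c -> 2 < #|G| ->
  \sum_(w : G) \sum_(f in edges G) sep (dist w) (edist f) + 3 <= #|G| ^ 2.
Proof.
move=> conG st n2; have st' := star_triangle_sym st.
rewrite -edge_sum_sep // (edge_sum_dart_sum (fun u v => nv u v * me v u)).
rewrite (star_dart_sum st).
have p (x y k : nat) : x <= 1 -> y <= k -> x * y <= k.
  by move=> xk y1; rewrite -[k]mul1n leq_mul.
have leaves : \sum_(l | l \notin [:: a; b;
  c]) (nv a l * me l a + nv l a * me a l)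
    <= (#|G| - 3) * (#|G| - 1).
  rewrite -(star_card_leaves st) -sum_nat_const; apply: leq_sum => l lr.
  have := star_me_center st l; move: lr; rewrite !inE !negb_or.
  case/and3P=> la /negPf-> /negPf-> /=; rewrite leqn0 => /eqP->.
  by rewrite muln0 add0n p ?(star_nv_center st) ?(star_me_to_leaf st).
have h1 := star_me_center st b; have h2 := star_me_center st c.
rewrite !inE !eqxx ?orbT in h1 h2.
have h3 := star_me_to_base st; have h4 := star_me_to_base st'.
have h5 := star_me_base st conG; have h6 := star_me_base st' conG.
have k1 := star_nv_center st b; have k2 := star_nv_center st c.
have k3 := star_nv_to_base st; have k4 := star_nv_to_base st'.
have k5 := star_nv_base st conG; have k6 := star_nv_base st' conG.
have := p _ _ _ k1 h3; have := p _ _ _ k2 h4; have := p _ _ _ h1 k3.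
have := p _ _ _ h2 k4; have := p _ _ _ k5 h6; have := p _ _ _ k6 h5.
rewrite [me b a * _]mulnC [me c a * _]mulnC => ? ? ? ? ? ?.
have sq : #|G| ^ 2 = (#|G| - 3) * (#|G| - 1) + 4 * #|G| - 3.
  by case: #|G| n2 => [|[|[|m]]] // _; rewrite !subSS !subn0; lia.
lia.
Qed.

(** * The lower bounds for cacti *)

Import GRing.Theory Num.Theory.

Theorem corollary1p2 (n k : nat) (hn : 5 <= n) (hk : k <> 0)
    (G : sgraph) (hG : cactus_class n k G) :
  (2 * n - 3 <= Sz_e G /\
   (Sz_e G = 2 * n - 3 <-> graph_iso G (C0 n))) /\
  (((n%:R ^+ 2 - 3) / 2 <= Sz_ev G :> rat)%R /\
   ((Sz_ev G = (n%:R ^+ 2 - 3) / 2 :> rat)%R <-> graph_iso G (C0 n))).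
Proof.
have [cG nG kG] := hG; have conG := cactus_connected cG.
have [H cH] : exists H : subgr G, is_cycle H.
  have : 0 < num_cycles G by rewrite kG lt0n; apply/eqP.
  by case/card_gt0P => H; rewrite inE; exists H.
have [gate [g [c gc]]] := cactus_gated_cycle cG cH.
have n4 : 4 < #|G| by rewrite nG.
have n2 : 2 < #|G| by apply: leq_trans n4.
have isoP : graph_iso G (C0 n) <-> exists a b d, @star_triangle G a b d.
  split=> [|[a [b [d st]]]]; last exact: star_triangle_iso st nG.
  by apply: iso_star_triangle; rewrite -nG.
split.
  have ge := Sz_e_geq conG gc n4; rewrite nG in ge.
  split; first by lia.
  rewrite isoP; split=> [e|[a [b [d st]]]].
    by apply: (Sz_e_tight conG gc n4); rewrite nG; lia.
  by have := star_Sz_e_leq conG st n2; rewrite nG; lia.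
pose T := edge_sum (fun u v : G => nv u v * me v u + nv v u * me u v).
have ge : n ^ 2 <= T + 3.
  by have := vertex_edge_sum_geq conG gc; rewrite -edge_sum_sep // nG.
have tight : T + 3 = n ^ 2 <-> graph_iso G (C0 n).
  rewrite isoP; split=> [e|[a [b [d st]]]].
    by apply: (vertex_edge_sum_tight conG gc); rewrite -edge_sum_sep // nG.
  apply/eqP; rewrite eqn_leq ge andbT.
  by have := star_vertex_edge_sum_leq conG st n2; rewrite -edge_sum_sep // nG.
rewrite -tight /Sz_ev -/T; split.
  rewrite ler_pM2r ?invr_gt0 ?ltr0n // lerBlDr -natrX -natrD ler_nat.
  exact: ge.
have half0 : (2^-1 : rat) != 0%R by [].
split=> [/(mulIf half0)/eqP|e].
  by rewrite eq_sym subr_eq -natrX -natrD eqr_nat => /eqP.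
congr (_ / _)%R; apply/eqP; rewrite eq_sym subr_eq -natrX -natrD eqr_nat.
by rewrite e.
Qed.
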